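(* For $k \in \mathbb{Z}$ let $H_k = \mathbb{Z}^2 \rtimes G_2$, where $G_2 = \langle a, b \mid aba^{-1}b \rangle$ and the generators $a$ and $b$ act on $\mathbb{Z}^2$ by multiplication by the matrices $A = \begin{pmatrix} 0 & 1 \\ 1 & 0 \end{pmatrix}$ and $B_k = \begin{pmatrix} 0 & 1 \\ -1 & k \end{pmatrix}$, respectively. Then $\mathrm{mdeg}(H_2) = 2$, and $\mathrm{mdeg}(H_k) = 1$ for all integers $k \neq 2$.
   Context: For a finitely generated group $G$, $m_n(G)$ denotes the number of maximal subgroups of $G$ of index $n$, and for $G$ with polynomially bounded $m_n(G)$, $\mathrm{mdeg}(G) = \inf\{\alpha \mid m_n(G) \le n^\alpha \text{ for all large } n\} = \limsup_{n \to \infty} \frac{\log m_n(G)}{\log n}$. Elements of $\mathbb{Z}^2$ are viewed as column vectors. Since $A, B_k \in \mathrm{GL}_2(\mathbb{Z})$ and $A B_k A^{-1} B_k = I_2$, the assignment $a \mapsto A$, $b \mapsto B_k$ defines an action of $G_2$ on $\mathbb{Z}^2$; in the semidirect product $H_k$, $G_2$ acts on $\mathbb{Z}^2$ by conjugation via this action. *)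

(* Defs.v *)
From HB Require Import structures.
From mathcomp Require Import all_boot all_order all_algebra.
From mathcomp Require Import all_classical all_reals all_analysis.

Set Implicit Arguments.
Unset Strict Implicit.
Unset Printing Implicit Defensive.

Import Order.TTheory GRing.Theory Num.Theory.

Local Open Scope classical_set_scope.
Local Open Scope ring_scope.

(* The letter (x, false) stands for x, and (x, true) for x^-1. *)
Definition word (X : choiceType) := seq (X * bool).

Definition inv_word (X : choiceType) (w : word X) : word X :=
  rev [seq (l.1, ~~ l.2) | l <- w].

(* The least congruence on words containing the free cancellations and making
   every relator trivial. *)
Inductive pres_eq (X : choiceType) (rels : set (word X)) :
    word X -> word X -> Prop :=
| PresRefl u : pres_eq rels u u
| PresSym u v : pres_eq rels u v -> pres_eq rels v u
| PresTrans u v w : pres_eq rels u v -> pres_eq rels v w -> pres_eq rels u w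
| PresCat u u' v v' :
    pres_eq rels u u' -> pres_eq rels v v' -> pres_eq rels (u ++ v) (u' ++ v')
| PresCancel x e : pres_eq rels [:: (x, e); (x, ~~ e)] [::]
| PresRel r : rels r -> pres_eq rels r [::].

Section Presented.
Variables (X : choiceType) (rels : set (word X)).

Definition pres_eqb : rel (word X) := fun u v => `[< pres_eq rels u v >].

Lemma pres_eqb_refl : reflexive pres_eqb.
Proof. by move=> u; apply/asboolP; exact: PresRefl. Qed.

Lemma pres_eqb_sym : symmetric pres_eqb.
Proof. by move=> u v; apply/asboolP/asboolP; exact: PresSym. Qed.

Lemma pres_eqb_trans : transitive pres_eqb.
Proof.
by move=> v u w /asboolP uv /asboolP vw; apply/asboolP; exact: PresTrans vw.
Qed.

Canonical pres_equiv := EquivRel pres_eqb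
  pres_eqb_refl pres_eqb_sym pres_eqb_trans.

Definition presented : Type := {eq_quot pres_eqb}%qT.

HB.instance Definition _ := Choice.on presented.
HB.instance Definition _ := Quotient.on presented.

Definition pres_class (w : word X) : presented := (\pi_presented w)%qT.

Lemma pres_classP u v : pres_class u = pres_class v <-> pres_eq rels u v.
Proof.
split=> [e|e]; last by apply/eqmodP; apply/asboolP.
by have /eqmodP/asboolP := e.
Qed.

Lemma pres_class_repr (g : presented) : pres_class (repr g) = g.
Proof. exact: reprK. Qed.

Lemma inv_word_cat (u v : word X) :
  inv_word (u ++ v) = inv_word v ++ inv_word u.
Proof. by rewrite /inv_word map_cat rev_cat. Qed.

Lemma inv_wordK : involutive (@inv_word X).
Proof.
move=> w; rewrite /inv_word map_rev revK -map_comp -[RHS]map_id.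
by apply: eq_map => -[x e] /=; rewrite negbK.
Qed.

Lemma pres_mulwV (w : word X) : pres_eq rels (w ++ inv_word w) [::].
Proof.
elim: w => [|[x e] w IH]; first exact: PresRefl.
rewrite -cat1s inv_word_cat -catA (catA w).
apply: (PresTrans (v := [:: (x, e)] ++ ([::] ++ inv_word [:: (x, e)]))).
  by apply: PresCat (PresRefl _ _) (PresCat IH (PresRefl _ _)).
exact: PresCancel.
Qed.

Lemma pres_mulVw (w : word X) : pres_eq rels (inv_word w ++ w) [::].
Proof. by have := pres_mulwV (inv_word w); rewrite inv_wordK. Qed.

Lemma pres_eq_inv (u v : word X) :
  pres_eq rels u v -> pres_eq rels (inv_word u) (inv_word v).
Proof.
move=> uv; apply: (PresTrans (v := inv_word u ++ (v ++ inv_word v))).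
  rewrite -[X in pres_eq _ X]cats0.
  exact: PresCat (PresRefl _ _) (PresSym (pres_mulwV v)).
rewrite catA -[X in pres_eq _ _ X]cat0s; apply: PresCat (PresRefl _ _).
apply: PresTrans (pres_mulVw u).
exact: PresCat (PresRefl _ _) (PresSym uv).
Qed.

Definition pres_mul (g h : presented) : presented :=
  pres_class (repr g ++ repr h).
Definition pres_one : presented := pres_class [::].
Definition pres_inv (g : presented) : presented :=
  pres_class (inv_word (repr g)).

Lemma pres_eq_repr (w : word X) : pres_eq rels (repr (pres_class w)) w.
Proof. by apply/pres_classP; rewrite pres_class_repr. Qed.

Lemma pres_class_cat (u v : word X) :
  pres_class (u ++ v) = pres_mul (pres_class u) (pres_class v).
Proof.
by apply/pres_classP/PresSym; apply: PresCat; exact: pres_eq_repr.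
Qed.

Lemma pres_class_inv (u : word X) :
  pres_class (inv_word u) = pres_inv (pres_class u).
Proof. by apply/pres_classP/PresSym/pres_eq_inv; exact: pres_eq_repr. Qed.

Lemma pres_mulA : associative pres_mul.
Proof.
move=> g h k.
rewrite -[g]pres_class_repr -[h]pres_class_repr -[k]pres_class_repr.
by rewrite -!pres_class_cat catA.
Qed.

Lemma pres_mul1g : left_id pres_one pres_mul.
Proof. by move=> g; rewrite -[g]pres_class_repr -pres_class_cat. Qed.

Lemma pres_mulg1 : right_id pres_one pres_mul.
Proof. by move=> g; rewrite -[g]pres_class_repr -pres_class_cat cats0. Qed.

Lemma pres_mulVg : left_inverse pres_one pres_inv pres_mul.
Proof.
move=> g; rewrite -[g]pres_class_repr -pres_class_inv -pres_class_cat.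
by apply/pres_classP; exact: pres_mulVw.
Qed.

Lemma pres_mulgV : right_inverse pres_one pres_inv pres_mul.
Proof.
move=> g; rewrite -[g]pres_class_repr -pres_class_inv -pres_class_cat.
by apply/pres_classP; exact: pres_mulwV.
Qed.

HB.instance Definition _ := isGroup.Build presented
  pres_mulA pres_mul1g pres_mulg1 pres_mulVg pres_mulgV.

Definition pres_gen (x : X) : presented := pres_class [:: (x, false)].

End Presented.

(* Homomorphisms from < X | rels > to the unit group of a ring A. *)
Section Evaluation.
Variables (X : choiceType) (A : unitRingType) (f : X -> A).

Definition eval_word (w : word X) : A :=
  \prod_(l <- w) (if l.2 then (f l.1)^-1 else f l.1).

Variable rels : set (word X).

Definition pres_eval (g : presented rels) : A := eval_word (repr g).

Hypothesis f_unit : forall x, f x \is a GRing.unit.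
Hypothesis f_rels : forall r, rels r -> eval_word r = 1.

Lemma eval_word_cat (u v : word X) :
  eval_word (u ++ v) = eval_word u * eval_word v.
Proof. by rewrite /eval_word big_cat. Qed.

Lemma eval_word_pres_eq (u v : word X) :
  pres_eq rels u v -> eval_word u = eval_word v.
Proof.
elim=> // [u0 v0 w _ -> _ -> //|u0 u1 v0 v1 _ eu _ ev|x [] |r /f_rels ->].
- by rewrite !eval_word_cat eu ev.
- by rewrite /eval_word !big_cons !big_nil /= mulr1 mulVr.
- by rewrite /eval_word !big_cons !big_nil /= mulr1 mulrV.
- by rewrite /eval_word big_nil.
Qed.

Lemma pres_eval_class (w : word X) : pres_eval (pres_class rels w) = eval_word w.
Proof. by apply: eval_word_pres_eq; exact: pres_eq_repr. Qed.

Lemma pres_eval_gen (x : X) : pres_eval (pres_gen rels x) = f x.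
Proof. by rewrite pres_eval_class /eval_word big_seq1. Qed.

Lemma pres_eval1 : pres_eval 1%g = 1.
Proof. by rewrite pres_eval_class /eval_word big_nil. Qed.

Lemma pres_evalM (g h : presented rels) :
  pres_eval (g * h)%g = pres_eval g * pres_eval h.
Proof. by rewrite pres_eval_class eval_word_cat. Qed.

End Evaluation.

(* Left actions of a group on an additive abelian group by automorphisms. *)
Record aut_action (G : groupType) (V : zmodType) := AutAction {
  aut_act :> G -> V -> V;
  aut_act1 : forall v, aut_act 1%g v = v;
  aut_actM : forall g h v, aut_act (g * h)%g v = aut_act g (aut_act h v);
  aut_actD : forall g, {morph aut_act g : u v / u + v}
}.

Definition sdprod (G : groupType) (V : zmodType) (act : aut_action G V) : Type :=
  (V * G)%type.

Section SemidirectProduct.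
Variables (G : groupType) (V : zmodType) (act : aut_action G V).

Local Notation sdprod := (sdprod act).

HB.instance Definition _ := Choice.copy sdprod (V * G)%type.

Definition sd_mul (x y : sdprod) : sdprod :=
  (x.1 + act x.2 y.1, (x.2 * y.2)%g).
Definition sd_one : sdprod := (0, 1%g).
Definition sd_inv (x : sdprod) : sdprod := (- act x.2^-1%g x.1, x.2^-1%g).

Lemma aut_act0 g : act g 0 = 0.
Proof. by apply: (addrI (act g 0)); rewrite -aut_actD !addr0. Qed.

Lemma aut_actN g v : act g (- v) = - act g v.
Proof. by apply: (addrI (act g v)); rewrite -aut_actD !subrr aut_act0. Qed.

Lemma sd_mulA : associative sd_mul.
Proof.
by move=> x y z; rewrite /sd_mul /= aut_actD addrA aut_actM mulgA.
Qed.

Lemma sd_mul1g : left_id sd_one sd_mul.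
Proof. by case=> v g; rewrite /sd_mul /= aut_act1 add0r mul1g. Qed.

Lemma sd_mulg1 : right_id sd_one sd_mul.
Proof. by case=> v g; rewrite /sd_mul /= aut_act0 addr0 mulg1. Qed.

Lemma sd_mulVg : left_inverse sd_one sd_inv sd_mul.
Proof. by case=> v g; rewrite /sd_mul /= addNr mulVg. Qed.

Lemma sd_mulgV : right_inverse sd_one sd_inv sd_mul.
Proof.
by case=> v g; rewrite /sd_mul /= aut_actN -aut_actM mulgV aut_act1 subrr.
Qed.

HB.instance Definition _ := isGroup.Build sdprod
  sd_mulA sd_mul1g sd_mulg1 sd_mulVg sd_mulgV.

Lemma sd_mulE (x y : sdprod) :
  (x * y)%g = (x.1 + act x.2 y.1, (x.2 * y.2)%g).
Proof. by []. Qed.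

Definition sd_inl (v : V) : sdprod := (v, 1%g).
Definition sd_inr (g : G) : sdprod := (0, g).

Lemma sd_conj (g : G) (v : V) :
  (sd_inr g * sd_inl v * (sd_inr g)^-1)%g = sd_inl (act g v).
Proof.
rewrite !sd_mulE /sd_inl /=.
by rewrite aut_act0 oppr0 aut_act0 add0r addr0 mulg1 mulgV.
Qed.

End SemidirectProduct.

(* The two-element set of generators is bool. *)
Notation gen_a := true (only parsing).
Notation gen_b := false (only parsing).

Definition relator : word bool :=
  [:: (gen_a, false); (gen_b, false); (gen_a, true); (gen_b, false)].

Definition G2 : groupType := presented [set relator].

Definition mx22 (a b c d : int) : 'M[int]_2 :=
  \matrix_(i, j) nth 0 (nth [::] [:: [:: a; b]; [:: c; d]] i) j.

Definition matA : 'M[int]_2 := mx22 0 1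
                                    1 0.

Definition matB (k : int) : 'M[int]_2 := mx22 0    1
                                              (-1) k.

Definition gen_mx (k : int) (x : bool) : 'M[int]_2 :=
  if x then matA else matB k.

Lemma mx22M a b c d a' b' c' d' : mx22 a b c d * mx22 a' b' c' d' =
  mx22 (a * a' + b * c') (a * b' + b * d') (c * a' + d * c') (c * b' + d * d').
Proof.
apply/matrixP => i j; rewrite !mxE !big_ord_recl big_ord0 !mxE /= addr0.
by case: i => -[|[|//]] ?; case: j => -[|[|//]] ?.
Qed.

Lemma mx22_1 : mx22 1 0 0 1 = 1.
Proof.
by apply/matrixP => i j; rewrite !mxE; case: i => -[|[|//]] ?;
   case: j => -[|[|//]] ?.
Qed.

Lemma matAA : matA * matA = 1.
Proof. by rewrite mx22M -mx22_1; congr mx22. Qed.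

Lemma matA_unit : matA \is a GRing.unit.
Proof. by apply/unitrP; exists matA; rewrite matAA. Qed.

Lemma matA_inv : matA^-1 = matA.
Proof. by rewrite -[LHS]mulr1 -matAA mulKr ?matA_unit. Qed.

Lemma matB_unit k : matB k \is a GRing.unit.
Proof.
apply/unitrP; exists (mx22 k (-1) 1 0).
rewrite !mx22M -mx22_1 !(mul0r, mulr0, mul1r, mulr1, mulrN, mulNr, add0r, addr0).
by rewrite opprK addNr subrr.
Qed.

Lemma gen_mx_unit k x : gen_mx k x \is a GRing.unit.
Proof. by case: x; [exact: matA_unit | exact: matB_unit]. Qed.

Lemma gen_mx_relator k r : [set relator] r -> eval_word (gen_mx k) r = 1.
Proof.
move=> ->; rewrite /eval_word !big_cons big_nil /= mulr1 matA_inv !mulrA !mx22M.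
rewrite -mx22_1 !(mul0r, mulr0, mul1r, mulr1, mulrN, mulNr, add0r, addr0).
by rewrite opprK subrr.
Qed.

Definition rho (k : int) (g : G2) : 'M[int]_2 := pres_eval (gen_mx k) g.

Lemma rho_a k : rho k (pres_gen _ gen_a) = matA.
Proof. exact: (pres_eval_gen (gen_mx_unit k) (@gen_mx_relator k)). Qed.

Lemma rho_b k : rho k (pres_gen _ gen_b) = matB k.
Proof. exact: (pres_eval_gen (gen_mx_unit k) (@gen_mx_relator k)). Qed.

Lemma rho_act1 k (v : 'cV[int]_2) : rho k 1%g *m v = v.
Proof.
rewrite /rho (pres_eval1 (gen_mx_unit k) (@gen_mx_relator k)).
exact: mul1mx.
Qed.

Lemma rho_actM k g h (v : 'cV[int]_2) :
  rho k (g * h)%g *m v = rho k g *m (rho k h *m v).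
Proof.
rewrite /rho (pres_evalM (gen_mx_unit k) (@gen_mx_relator k)).
by rewrite mulmxA.
Qed.

Lemma rho_actD k g : {morph (fun v : 'cV[int]_2 => rho k g *m v) : u v / u + v}.
Proof. by move=> u v; rewrite mulmxDr. Qed.

Definition Z2_action (k : int) : aut_action G2 'cV[int]_2 :=
  AutAction (@rho_act1 k) (@rho_actM k) (@rho_actD k).

Definition Hgrp (k : int) : groupType := sdprod (Z2_action k).

Definition is_subgroup (G : groupType) (K : set G) : Prop :=
  [/\ K 1%g, (forall x y, K x -> K y -> K (x * y)%g) &
      (forall x, K x -> K x^-1%g)].

Definition lcosets (G : groupType) (K : set G) : set (set G) :=
  [set [set (x * y)%g | y in K] | x in [set: G]].

Definition has_index (G : groupType) (K : set G) (n : nat) : Prop :=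
  (lcosets K #= `I_n)%card.

Definition is_maximal_subgroup (G : groupType) (K : set G) : Prop :=
  [/\ is_subgroup K, K <> setT &
      forall L : set G, is_subgroup L -> K `<=` L -> L = K \/ L = setT].

(* m_n(G), with value +oo when there are infinitely many such subgroups (which
   does not happen for finitely generated G). *)
Definition max_subgroup_count (R : realType) (G : groupType) (n : nat) : \bar R :=
  counting [set K : set G | is_maximal_subgroup K /\ has_index K n].

(* The infimum is taken in the extended reals: it is +oo exactly when m_n(G) is
   not polynomially bounded. *)
Definition mdeg (R : realType) (G : groupType) : \bar R :=
  ereal_inf [set alpha%:E | alpha in [set alpha : R |
    \forall n \near \oo,
      (max_subgroup_count R G n <= (n%:R `^ alpha)%:E)%E]].

(* Main.v *)
From HB Require Import structures.
Require Import Defs.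
From mathcomp Require Import all_boot all_order all_algebra.
From mathcomp Require Import all_classical all_reals all_analysis.
From mathcomp Require Import finmap zify ring lra.

(* Let T be the translation subgroup Z^2 and let K be a maximal subgroup of
   index n of H_k. If K contains T and b, then K is determined by n; if it
   contains T but not b, then b^j is in K iff n | j, and K is determined by the
   residue mod n of an i with b^i a in K. Otherwise K T = H_k, and K meets T in
   a maximal proper sublattice stable under A and B, which is p Z^2 or
   {(x, y) : y = x mod p} or {(x, y) : y = - x mod p} with p = pdiv n; K is then
   determined by this lattice and by the classes modulo it of u, v with u a and
   v b in K. This gives O(n^2) subgroups. When n > (k - 2)^2 > 0, the relation
   a b a^-1 b = 1 determines the class of u from that of v, which leaves O(n).

   Conversely, for a transitive action of H_k on Z/p by affine maps of slope 1
   or -1, the stabiliser of 0 is maximal of index p. For any k, letting a act as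
   x |-> s - x, b as x |-> x + 1 and T trivially gives p of them. For k = 2, the
   functional (x, y) |-> y - x is an eigenvector of both A and B, so T may act
   by translations, b as x |-> x + t and a as x |-> s - x, with s and t free:
   this gives p^2. *)

Set Implicit Arguments.
Unset Strict Implicit.
Unset Printing Implicit Defensive.

Import Order.TTheory GRing.Theory Num.Theory.

Local Open Scope classical_set_scope.
Local Open Scope ring_scope.

(** * Counting and growth *)

(** [code] is a relation, so an element may carry several codes and none has to be canonical;
    picking one code for each element of [S] gives an injection into [I]. *)
Lemma counting_le (R : realType) (T : choiceType) (I : finType) (S : set T)
    (code : I -> T -> Prop) :
  (forall x, S x -> exists i, code i x) ->
  (forall i x y, S x -> S y -> code i x -> code i y -> x = y) ->
  (counting S <= (#|I|%:R : R)%:E)%E.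
Proof.
move=> codeS code_inj.
(* The [option] serves the points outside [S], which may have no code at all. *)
have /choice[f fP] (x : T) : exists o : option I,
    S x -> exists2 i, o = Some i & code i x.
  have [/codeS[i ci]|nSx] := pselect (S x); last by exists None.
  by exists (Some i) => _; exists i.
have leS : (S #<= `I_#|I|)%card.
  have [->|/set0P[x0 Sx0]] := eqVneq S set0; first exact: card_ge0.
  have [i0 _ _] := fP x0 Sx0.
  have inj : {in S &, injective (fun x => enum_rank (odflt i0 (f x)) : nat)}.
    move=> x y /set_mem Sx /set_mem Sy /= /val_inj/enum_rank_inj.
    have [i -> ci] := fP x Sx; have [j -> cj] := fP y Sy => /= ij.
    by apply: (code_inj i) => //; rewrite ij.
  rewrite -(card_le_eql (inj_card_eq inj)).
  by apply: subset_card_le => _ [x Sx <-] /=.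
have finS : finite_set S by apply: card_le_finite leS (finite_II _).
rewrite /counting asboolT// lee_fin ler_nat.
exact: geq_card_fset_set.
Qed.

Lemma counting_ge (R : realType) (T : choiceType) (I : finType) (S : set T)
    (f : I -> T) :
  injective f -> (forall i, S (f i)) -> ((#|I|%:R : R)%:E <= counting S)%E.
Proof.
move=> f_inj fS; rewrite /counting; case: asboolP => [finS|_]; last by rewrite leey.
rewrite lee_fin ler_nat -[#|I|]card_ord.
have -> : #|{: 'I_#|I|}| = #|I| by rewrite card_ord.
have -> : #|I| = #|` [fset f i | i in I]%fset|.
  by rewrite card_imfset//= -cardE.
apply: fsubset_leq_card; apply/fsubsetP => _ /imfsetP[i _ ->].
by rewrite in_fset_set//; apply/mem_set; exact: fS.
Qed.

(** * Left cosets and the index of a subgroup *)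

Section Index.
Variables (G : groupType) (K : set G).
Hypothesis K_sub : is_subgroup K.

Lemma coset_eqP (x y : G) :
  [set (x * z)%g | z in K] = [set (y * z)%g | z in K] <-> K (x^-1 * y)%g.
Proof.
have [K1 KM KV] := K_sub; split=> [e|Kxy].
  have : [set (y * z)%g | z in K] y by exists 1%g; rewrite ?mulg1.
  by rewrite -e => -[z Kz <-]; rewrite mulKg.
apply/seteqP; split=> _ [z Kz <-].
- exists ((x^-1 * y)^-1 * z)%g; first by apply: KM => //; exact: KV.
  by rewrite invgM invgK !mulgA mulgV mul1g.
- exists ((x^-1 * y) * z)%g; first exact: KM.
  by rewrite !mulgA mulgV mul1g.
Qed.

Lemma transversal_index n (s : nat -> G) :
  (forall g, exists2 i, (i < n)%N & K ((s i)^-1 * g)%g) ->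
  (forall i j, (i < n)%N -> (j < n)%N -> K ((s i)^-1 * s j)%g -> i = j) ->
  has_index K n.
Proof.
move=> s_surj s_inj; rewrite /has_index.
have -> : lcosets K = (fun i => [set (s i * z)%g | z in K]) @` `I_n.
  apply/seteqP; split=> [_ [g _ <-]|_ [i _ <-]]; last by exists (s i).
  by have [i ltin Kig] := s_surj g; exists i => //; apply/coset_eqP.
apply: inj_card_eq => i j /set_mem ltin /set_mem ltjn /coset_eqP; exact: s_inj.
Qed.

Lemma index_fun n : has_index K n -> exists r : G -> nat,
  (forall x, (r x < n)%N) /\ (forall x y, r x = r y <-> K (x^-1 * y)%g).
Proof.
move=> /pcard_eqP/bijPex[f [fun_f inj_f _]].
exists (fun x => f [set (x * z)%g | z in K]); split=> [x|x y].
  by apply: fun_f; exists x.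
split=> [e|/coset_eqP -> //]; apply/coset_eqP.
by apply: inj_f => //; apply/mem_set; [exists x | exists y].
Qed.

Lemma index_unique m n : has_index K m -> has_index K n -> m = n.
Proof.
by move=> /card_esym Km Kn; apply/card_eq_II; exact: card_eq_trans Km Kn.
Qed.

End Index.

(** With e = al - d > 0, n^al = n^d n^e, and n^e >= C as soon as n >= C^(1/e). *)
Lemma near_le_powR (R : realType) (d C : nat) (al : R) : d%:R < al ->
  \forall n \near \oo, ((C * n ^ d)%N%:R : R) <= n%:R `^ al.
Proof.
move=> dal; have e0 : 0 < al - d%:R by rewrite subr_gt0.
set e := al - d%:R in e0.
near=> n.
have n0 : (0 < n)%N by near: n; exists 1%N.
have nR0 : 0 < (n%:R : R) by rewrite ltr0n.
have -> : al = d%:R + e by rewrite /e addrC subrK.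
rewrite powRD; last by rewrite (gt_eqF nR0) implybT.
rewrite powR_mulrn ?ler0n// natrM natrX mulrC ler_wpM2l ?exprn_ge0 ?ler0n//.
have -> : (C%:R : R) = (C%:R `^ (e^-1)) `^ e.
  by rewrite -powRrM mulVf ?gt_eqF// powRr1.
apply: ge0_ler_powR; rewrite ?nnegrE ?ler0n ?powR_ge0//; first exact: ltW.
near: n; exact: nbhs_infty_ger.
Unshelve. all: by end_near.
Qed.

(** Every exponent d + e with e > 0 is admissible by [near_le_powR], so the infimum is at most d. An
    admissible al satisfies p^d <= p^al at some prime p beyond its threshold, and taking logarithms
    gives d <= al. *)
Lemma mdeg_eq (R : realType) (G : groupType) (d C : nat) :
  (\forall n \near \oo, (max_subgroup_count R G n <= (C * n ^ d)%N%:R%:E)%E) ->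
  (forall p, prime p -> odd p ->
     ((p ^ d)%N%:R%:E <= max_subgroup_count R G p)%E) ->
  mdeg R G = d%:R%:E.
Proof.
move=> upper lower; apply/eqP; rewrite eq_le; apply/andP; split.
  apply/lee_addgt0Pr => e e0; apply: ereal_inf_lbound.
  exists (d%:R + e) => //=; have de : d%:R < d%:R + e by rewrite ltrDl.
  have := near_le_powR C de; apply: filterS2 upper => n up ne.
  by apply: le_trans up _; rewrite lee_fin.
apply: le_ereal_inf_tmp => _ [al /= [m _ mP] <-].
(* A prime above m + 2 lies beyond the threshold m and differs from 2. *)
have [p ltp pr_p] := prime_above (m + 2).
have podd : odd p by case: (even_prime pr_p) => [p2|//]; lia.
have := le_trans (lower p pr_p podd) (mP p _); rewrite /= lee_fin => le.
have {}le : (p ^ d)%N%:R <= (p%:R : R) `^ al by apply: le; lia.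
rewrite lee_fin.
have p1 : 1 < (p%:R : R) by rewrite ltr1n prime_gt1.
have p0 : 0 < (p%:R : R) by rewrite (lt_trans ltr01).
move: le; rewrite natrX -powR_mulrn ?ler0n//.
rewrite -ler_ln ?posrE ?powR_gt0// !ln_powR ler_pM2r//.
by rewrite ln_gt0.
Qed.

(** * Affine actions and the lower bounds *)

Lemma dvdz_sub_small p i j : (i < p)%N -> (j < p)%N ->
  (p%:Z %| i%:Z - j%:Z)%Z -> i = j.
Proof.
by move=> ip jp; rewrite -eqz_mod_dvd !modz_nat !modn_small// => /eqP[].
Qed.

Section Cocycle.
Variables (G : groupType) (F sg : G -> int) (w : G) (p : nat).
Hypothesis FM : forall x y, F (x * y)%g = F x + sg x * F y.
Hypothesis sgM : forall x y, sg (x * y)%g = sg x * sg y.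
Hypothesis sg1 : sg 1%g = 1.
Hypotheses (Fw : F w = 1) (sgw : sg w = 1).

(** The relation [FM] says that x acts on the integers by z |-> sg x * z + F x, so F x is the image
    of 0 and this set is the stabiliser of 0 modulo p. The element w acts as z |-> z + 1, which
    makes the action transitive. *)
Definition cocycle_kernel : set G := [set x | (p%:Z %| F x)%Z].

Lemma cocycle1 : F 1%g = 0.
Proof. by have := FM 1 1; rewrite mulg1 sg1; lia. Qed.

Lemma cocycleV x : F x^-1%g = - (sg x^-1%g * F x).
Proof. by have := FM x^-1 x; rewrite mulVg cocycle1; lia. Qed.

Lemma cocycleX i : F (w ^+ i)%g = i%:Z /\ sg (w ^+ i)%g = 1.
Proof.
elim: i => [|i [IHF IHs]]; first by rewrite expg0 cocycle1 sg1.
by rewrite expgS FM sgM Fw sgw IHF IHs; split; lia.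
Qed.

Lemma cocycle_divl i g : F ((w ^+ i)^-1 * g)%g = F g - i%:Z.
Proof.
have := FM (w ^+ i)%g ((w ^+ i)^-1 * g)%g.
by rewrite mulVKg; case: (cocycleX i) => -> ->; lia.
Qed.

Lemma cocycle_kernel_sub : is_subgroup cocycle_kernel.
Proof.
split=> [|x y Kx Ky|x Kx] /=.
- by rewrite /cocycle_kernel /= cocycle1 dvdz0.
- by rewrite /cocycle_kernel /= FM rpredD// dvdz_mull.
- by rewrite /cocycle_kernel /= cocycleV rpredN dvdz_mull.
Qed.

Hypothesis p_pr : prime p.

Lemma cocycle_kernel_residue g : exists2 i, (i < p)%N &
  cocycle_kernel ((w ^+ i)^-1 * g)%g.
Proof.
have p0 : (p%:Z != 0) by have := prime_gt0 p_pr; lia.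
exists `|(F g %% p)%Z|%N.
  by have := modz_ge0 (F g) p0; have := ltz_pmod (F g) (_ : 0 < p%:Z); lia.
rewrite /cocycle_kernel /= cocycle_divl gez0_abs ?modz_ge0//.
by rewrite {1}(divz_eq (F g) p) addrK dvdz_mull.
Qed.

Lemma cocycle_kernel_index : has_index cocycle_kernel p.
Proof.
apply: (@transversal_index _ _ cocycle_kernel_sub p (fun i => (w ^+ i)%g)).
  exact: cocycle_kernel_residue.
move=> i j ltip ltjp; rewrite /cocycle_kernel /= cocycle_divl.
by case: (cocycleX j) => -> _ /(dvdz_sub_small ltjp ltip) ->.
Qed.

(** A strictly larger L contains an element y outside the stabiliser, hence w^f for the residue 0 <
    f < p of F y. It also contains w^p, so it contains w, whose powers represent all cosets. *)
Lemma cocycle_kernel_maximal : is_maximal_subgroup cocycle_kernel.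
Proof.
have [K1 KM KV] := cocycle_kernel_sub.
split; first exact: cocycle_kernel_sub.
  move=> /seteqP[_ /(_ w I)]; rewrite /cocycle_kernel /= Fw dvdz1 => /eqP.
  by have := prime_gt1 p_pr; lia.
move=> L [L1 LM LV] KL; have [LK|] := pselect (L `<=` cocycle_kernel).
  by left; apply/seteqP.
move=> /existsNP[y /not_implyP[Ly nKy]]; right.
have [f ltfp Kfy] := cocycle_kernel_residue y.
have Lf : L (w ^+ f)%g.
  have -> : (w ^+ f = y * ((w ^+ f)^-1 * y)^-1)%g.
    by rewrite invgM invgK mulgA mulgV mul1g.
  by apply: LM => //; apply/LV/KL.
have Lp : L (w ^+ p)%g.
  by apply: KL; rewrite /cocycle_kernel /=; case: (cocycleX p) => ->.
have LX x i : L x -> L (x ^+ i)%g.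
  by move=> Lx; elim: i => [|i IH] //; rewrite expgS; exact: LM.
have f0 : (0 < f)%N.
  by rewrite lt0n; apply/eqP => f0; move: Kfy; rewrite f0 expg0 invg1 mul1g.
have Lw : L w.
  (* Bezout: u f = q p + gcd(f, p), and the gcd is 1 because 0 < f < p. *)
  have [u q uq _] := egcdnP p f0.
  have cop : gcdn f p = 1%N.
    apply/eqP; rewrite -/(coprime _ _) coprime_sym prime_coprime//.
    by rewrite gtnNdvd.
  have : L ((w ^+ p ^+ q)^-1 * w ^+ f ^+ u)%g by apply: LM; [apply/LV|]; exact: LX.
  by rewrite -!expgnA mulnC [(f * u)%N]mulnC uq cop expgnDr mulKg.
apply/seteqP; split=> // z _; have [i _ /KL Liz] := cocycle_kernel_residue z.
by rewrite -[z](mulVKg (w ^+ i)%g); apply: LM => //; exact: LX.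
Qed.

End Cocycle.

(** * Columns and two-by-two integer matrices in coordinates *)

Definition vec (x y : int) : 'cV[int]_2 := \col_i (if i == 0 then x else y).

Lemma vecE (v : 'cV[int]_2) : v = vec (v 0 0) (v 1 0).
Proof.
by apply/colP => i; rewrite !mxE; case: i => -[|[|//]] ? /=;
   congr (v _ _); exact: val_inj.
Qed.

Lemma vec0 x y : vec x y 0 0 = x. Proof. by rewrite mxE. Qed.
Lemma vec1 x y : vec x y 1 0 = y. Proof. by rewrite mxE. Qed.

Lemma vecD x y x' y' : vec x y + vec x' y' = vec (x + x') (y + y').
Proof. by apply/colP => i; rewrite !mxE; case: ifP. Qed.

Lemma vecN x y : - vec x y = vec (- x) (- y).
Proof. by apply/colP => i; rewrite !mxE; case: ifP. Qed.

Lemma mx22_vec a b c d x y :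
  mx22 a b c d *m vec x y = vec (a * x + b * y) (c * x + d * y).
Proof.
apply/colP => i; rewrite !mxE !big_ord_recl big_ord0 !mxE /= addr0.
by case: i => -[|[|//]] ?.
Qed.

Lemma mx22_unitV M N : M * N = 1 -> N * M = 1 ->
  (M : 'M[int]_2) \is a GRing.unit /\ M^-1 = N.
Proof.
move=> MN NM; have uM : M \is a GRing.unit by apply/unitrP; exists N.
by split=> //; rewrite -[LHS]mulr1 -MN mulKr.
Qed.

Lemma mx22_inj a b c d a' b' c' d' : mx22 a b c d = mx22 a' b' c' d' ->
  [/\ a = a', b = b', c = c' & d = d'].
Proof.
move=> /matrixP e; move: (e 0 0) (e 0 1) (e 1 0) (e 1 1).
by rewrite !mxE.
Qed.

(* x |-> - x + s and x |-> x + t, acting on the column (x, 1). *)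
Definition affine_gen (s t : int) (x : bool) : 'M[int]_2 :=
  if x then mx22 (-1) s 0 1 else mx22 1 t 0 1.

Section Affine.
Variables s t : int.
Local Notation gen := (affine_gen s t).

Lemma affine_genV x :
  gen x \is a GRing.unit /\
  (gen x)^-1 = if x then mx22 (-1) s 0 1 else mx22 1 (- t) 0 1.
Proof.
by case: x; apply: mx22_unitV; rewrite /affine_gen mx22M -mx22_1;
   congr mx22; ring.
Qed.

Lemma affine_gen_unit x : gen x \is a GRing.unit.
Proof. by case: (affine_genV x). Qed.

(** A reflection conjugates a translation to its inverse, whatever s and t are. *)
Lemma affine_relator r : [set relator] r -> eval_word gen r = 1.
Proof.
move=> ->; rewrite /eval_word !big_cons big_nil /= mulr1.
have [_ ->] := affine_genV true.
by rewrite /affine_gen !mx22M -mx22_1; congr mx22; ring.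
Qed.

Definition affine_rep (g : G2) : 'M[int]_2 := pres_eval gen g.
Definition affine_sign (g : G2) : int := affine_rep g 0 0.
Definition affine_shift (g : G2) : int := affine_rep g 0 1.

Lemma affine_repM g h : affine_rep (g * h)%g = affine_rep g * affine_rep h.
Proof. exact: (pres_evalM affine_gen_unit affine_relator). Qed.

Lemma affine_rep1 : affine_rep 1%g = 1.
Proof. exact: (pres_eval1 affine_gen_unit affine_relator). Qed.

Lemma affine_rep_gen x : affine_rep (pres_gen _ x) = gen x.
Proof. exact: (pres_eval_gen affine_gen_unit affine_relator). Qed.

Lemma affine_repE g : affine_rep g = mx22 (affine_sign g) (affine_shift g) 0 1.
Proof.
suff [a [b e]] : exists a b, affine_rep g = mx22 a b 0 1.
  by rewrite /affine_sign /affine_shift e !mxE.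
rewrite /affine_rep /pres_eval; elim: (repr g) => [|[x e] w [a [b IH]]].
  by exists 1, 0; rewrite /eval_word big_nil mx22_1.
have [_ genV] := affine_genV x.
rewrite /eval_word big_cons -/(eval_word gen w) IH /= genV.
by case: e; case: x {genV}; rewrite /affine_gen mx22M ?mul0r ?add0r ?mulr1;
   do 2 eexists; f_equal; ring.
Qed.

Lemma affine_signM g h : affine_sign (g * h)%g = affine_sign g * affine_sign h.
Proof.
have := affine_repM g h; rewrite !affine_repE mx22M => /mx22_inj[-> _ _ _].
by rewrite mulr0 addr0.
Qed.

Lemma affine_shiftM g h :
  affine_shift (g * h)%g = affine_shift g + affine_sign g * affine_shift h.
Proof.
have := affine_repM g h; rewrite !affine_repE mx22M => /mx22_inj[_ -> _ _].
by rewrite mulr1 addrC.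
Qed.

(** For k = 2 the functional y - x is negated by A and fixed by B, and these factors are the slopes
    of the affine maps attached to a and b. *)
Lemma affine_sign_rho2 g v : let psi (u : 'cV[int]_2) := u 1 0 - u 0 0 in
  psi (rho 2 g *m v) = affine_sign g * psi v.
Proof.
move=> psi; rewrite /affine_sign /affine_rep /rho /pres_eval.
suff: exists a b, eval_word gen (repr g) = mx22 a b 0 1 /\
    forall v, psi (eval_word (gen_mx 2) (repr g) *m v) = a * psi v.
  by move=> [a [b [-> ->]]]; rewrite mxE.
elim: (repr g) => [|[x e] w [a [b [IH IHv]]]].
  exists 1, 0; rewrite /eval_word !big_nil mx22_1; split=> // u.
  by rewrite mul1r; congr psi; exact: mul1mx.
have [_ genV] := affine_genV x.
rewrite /eval_word !big_cons -/(eval_word gen w) -/(eval_word (gen_mx 2) w).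
rewrite IH /= genV.
have BV : (matB 2)^-1 = mx22 2 (-1) 1 0.
  by apply: (proj2 (mx22_unitV _ _)); rewrite /matB mx22M -mx22_1; congr mx22.
have psiM m u : psi ((m * eval_word (gen_mx 2) w) *m u) =
    psi (m *m (eval_word (gen_mx 2) w *m u)) by rewrite mulmxA.
case: e; case: x {genV}; rewrite /affine_gen mx22M /gen_mx /= ?matA_inv ?BV;
  do 2 eexists; (split; first by f_equal; ring) => u; rewrite psiM;
  rewrite (vecE (eval_word _ w *m u)) mx22_vec;
  have := IHv u; rewrite /psi !vec0 !vec1 => e;
  by move: e; rewrite ?mul0r ?mulr0 ?addr0; move: (_ 0 0) (_ 1 0) => X Y; lia.
Qed.

End Affine.

(** The image of 0 when v in Z^2 translates by c times the functional y - x and G_2 acts through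
    [affine_rep]. The two actions are compatible when c = 0 or k = 2. *)
Definition affine_map (k c s t : int) (x : Hgrp k) : int :=
  affine_shift s t x.2 + c * (x.1 1 0 - x.1 0 0).

Section LowerBound.
Variables (k c s t : int) (p : nat).
Hypothesis ck : c = 0 \/ k = 2.
Local Notation F := (@affine_map k c s t).
Local Notation sg := (fun x : Hgrp k => affine_sign s t x.2).

Lemma affine_mapM (x y : Hgrp k) : F (x * y)%g = F x + sg x * F y.
Proof.
have addE (u v : 'cV[int]_2) i : (u + v) i 0 = u i 0 + v i 0 by rewrite mxE.
rewrite /affine_map sd_mulE /= affine_shiftM !addE.
case: ck => [->|k2]; first by rewrite !mul0r !addr0.
move: x y; rewrite k2 => x y; have := affine_sign_rho2 s t x.2 y.1.
by move=> /= /(congr1 (fun z => c * z)); lia.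
Qed.

Variable w : Hgrp k.
Hypothesis p_pr : prime p.
Hypotheses (Fw : F w = 1) (sgw : sg w = 1).

Let sgM (x y : Hgrp k) : sg (x * y)%g = sg x * sg y.
Proof. exact: affine_signM. Qed.

Let sg1 : sg 1%g = 1.
Proof. by rewrite /affine_sign affine_rep1 mxE. Qed.

Lemma affine_kernel_maximal :
  is_maximal_subgroup (cocycle_kernel F p) /\ has_index (cocycle_kernel F p) p.
Proof.
split; first exact: (cocycle_kernel_maximal affine_mapM sgM sg1 Fw sgw p_pr).
exact: (cocycle_kernel_index affine_mapM sgM sg1 Fw sgw p_pr).
Qed.

End LowerBound.

Lemma affine_shift_gen s t x :
  affine_shift s t (pres_gen _ x) = if x then s else t.
Proof. by rewrite /affine_shift affine_rep_gen; case: x; rewrite mxE. Qed.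

Lemma affine_sign_gen s t x :
  affine_sign s t (pres_gen _ x) = if x then -1 else 1.
Proof. by rewrite /affine_sign affine_rep_gen; case: x; rewrite mxE. Qed.

Lemma max_subgroup_count2_ge (R : realType) p : prime p ->
  ((p ^ 2)%N%:R%:E <= max_subgroup_count R (Hgrp 2) p)%E.
Proof.
move=> p_pr; have -> : (p ^ 2)%N = #|{: 'I_p * 'I_p}|.
  by rewrite card_prod card_ord mulnn.
pose f (st : 'I_p * 'I_p) : set (Hgrp 2) :=
  cocycle_kernel (@affine_map 2 1 st.1%:Z st.2%:Z) p.
apply: (@counting_ge _ _ _ _ f) => [[s t] [s' t'] e|[s t]]; last first.
  apply: (@affine_kernel_maximal 2 1 s t p _ (sd_inl _ (vec 0 1)) p_pr).
  - by right.
  - by rewrite /affine_map /affine_shift affine_rep1 !mxE /=.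
  - by rewrite /affine_sign affine_rep1 !mxE /=.
have main x (i j : 'I_p) : (forall s t, affine_shift s t (pres_gen _ x) =
    if x then s else t) ->
    (if x then s else t) = i -> (if x then s' else t') = j -> i = j.
  move=> shiftE ei ej.
  (* This element sends 0 to the parameter of the generator x minus i, so its membership tests
     whether that parameter is i modulo p. *)
  have : f (s, t) ((vec 0 (- (i : nat)%:Z), pres_gen _ x) : Hgrp 2).
    rewrite /f /cocycle_kernel /affine_map /= affine_shift_gen vec0 vec1 subr0.
    by case: (x) ei => ->; rewrite mul1r subrr dvdz0.
  rewrite e /f /cocycle_kernel /affine_map /= affine_shift_gen vec0 vec1 subr0.
  rewrite mul1r => h; apply/val_inj/esym/(@dvdz_sub_small p) => //=.
  by case: (x) ej h => <-.
have -> : s = s' by apply: (main true) => // *; exact: affine_shift_gen.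
have -> // : t = t' by apply: (main false) => // *; exact: affine_shift_gen.
Qed.

Lemma max_subgroup_count_ge (R : realType) k p : prime p ->
  (p%:R%:E <= max_subgroup_count R (Hgrp k) p)%E.
Proof.
move=> p_pr; have -> : (p%:R : R) = #|{: 'I_p}|%:R by rewrite card_ord.
pose w : Hgrp k := sd_inr _ (pres_gen _ false).
pose f (s : 'I_p) : set (Hgrp k) :=
  cocycle_kernel (@affine_map k 0 s%:Z 1) p.
have Fw s : @affine_map k 0 s 1 w = 1.
  by rewrite /affine_map affine_shift_gen mul0r addr0.
have sgw s : affine_sign s 1 w.2 = 1 by rewrite affine_sign_gen.
have ck : (0 : int) = 0 \/ k = 2 by left.
apply: (@counting_ge _ _ _ _ f) => [s s' e|s]; last first.
  exact: (@affine_kernel_maximal k 0 s 1 p ck w p_pr).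
(* b^(p - s) a sends 0 to p - s + s0, which for s0 < p is divisible by p only if s0 = s; the natural
   subtraction is exact since s < p. *)
pose x : Hgrp k := (w ^+ (p - s) * sd_inr _ (pres_gen _ true))%g.
have Fx (s0 : int) : @affine_map k 0 s0 1 x = (p - s)%N%:Z + s0.
  have sM (y z : Hgrp k) : affine_sign s0 1 (y * z)%g.2 =
     affine_sign s0 1 y.2 * affine_sign s0 1 z.2 by exact: affine_signM.
  have s1 : affine_sign s0 1 (1%g : Hgrp k).2 = 1.
    by rewrite /affine_sign affine_rep1 mxE.
  have [Fwi swi] := cocycleX (affine_mapM s0 1 ck) sM s1 (Fw s0) (sgw s0) (p - s)%N.
  rewrite /x (affine_mapM s0 1 ck) Fwi swi mul1r.
  by rewrite /affine_map affine_shift_gen mul0r addr0.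
have : f s x.
  rewrite /f /cocycle_kernel /= Fx.
  by rewrite (_ : _ + _ = p%:Z) ?dvdzz//; have := ltn_ord s; lia.
rewrite e /f /cocycle_kernel /= Fx => h; apply/val_inj/esym/(@dvdz_sub_small p) => //=.
rewrite (_ : _ - _ = ((p - s)%N%:Z + s'%:Z) - p%:Z).
  by rewrite rpredB ?dvdzz.
by have := ltn_ord s; lia.
Qed.

(** * Subgroups of finite index *)

Section IntegerPower.
Variable G : groupType.
Implicit Types (x y : G) (L N J K : set G).

Definition expz x (z : int) : G :=
  match z with Posz n => (x ^+ n)%g | Negz n => ((x ^+ n.+1)^-1)%g end.

Lemma expz_sub x m n : expz x (m%:Z - n%:Z) = (x ^+ m * (x ^+ n)^-1)%g.
Proof.
have [lenm|ltmn] := leqP n m.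
  by rewrite (_ : _ - _ = (m - n)%N%:Z) /= ?expgnFr//; lia.
have -> : m%:Z - n%:Z = Negz (n - m).-1 by lia.
rewrite /= prednK ?subn_gt0//.
by rewrite expgnFr 1?ltnW// invgF.
Qed.

Lemma expz_nat x n : expz x n%:Z = (x ^+ n)%g. Proof. by []. Qed.

Lemma int_sub_nat (z : int) : exists m n : nat, z = m%:Z - n%:Z.
Proof. by case: z => n; [exists n, 0%N | exists 0%N, n.+1]; lia. Qed.

Lemma expzD x (y z : int) : expz x (y + z) = (expz x y * expz x z)%g.
Proof.
have [m [n ->]] := int_sub_nat y; have [m' [n' ->]] := int_sub_nat z.
rewrite (_ : _ + _ = (m + m')%N%:Z - (n' + n)%N%:Z); last by lia.
rewrite !expz_sub !expgnDr invgM !mulgA; congr (_ * _)%g.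
rewrite -!mulgA; congr (_ * _)%g.
exact/commuteV/commuteX2/commute_refl.
Qed.

Lemma expzN x (z : int) : expz x (- z) = ((expz x z)^-1)%g.
Proof. by apply/esym/mulg1_eq; rewrite -expzD subrr. Qed.

Lemma expzM x (y z : int) : expz x (y * z) = expz (expz x y) z.
Proof.
elim: z => [|n IH|n IH]; first by rewrite mulr0.
  by rewrite -addn1 PoszD mulrDr mulr1 !expzD IH.
by rewrite -addn1 PoszD opprD mulrDr mulrN1 !expzD IH !expzN.
Qed.

Lemma expz_conj x y z : (x * expz y z * x^-1)%g = expz (x * y * x^-1)%g z.
Proof.
have conjX n : (x * y ^+ n * x^-1 = (x * y * x^-1) ^+ n)%g.
  elim: n => [|n IH]; first by rewrite !expg0 mulg1 mulgV.
  by rewrite !expgS -IH !mulgA mulgVK.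
case: z => n /=; first exact: conjX.
by rewrite -conjX !invgM invgK mulgA.
Qed.

Lemma subgroup_expz K x z : is_subgroup K -> K x -> K (expz x z).
Proof.
move=> [K1 KM KV] Kx; have KX n : K (x ^+ n)%g.
  by elim: n => [|n IH] //; rewrite expgS; exact: KM.
by case: z => n /=; [|apply: KV]; exact: KX.
Qed.

Lemma expz_subgroup x : is_subgroup (range (expz x)).
Proof.
split; first by exists 0.
  by move=> _ _ [y _ <-] [z _ <-]; exists (y + z) => //; rewrite expzD.
by move=> _ [z _ <-]; exists (- z) => //; rewrite expzN.
Qed.

Definition is_normal N := is_subgroup N /\ forall x y, N y -> N (x * y * x^-1)%g.

Lemma normal_conjV N x y : is_normal N -> N y -> N (x^-1 * y * x)%g.
Proof. by move=> [_ /(_ x^-1%g y)]; rewrite invgK. Qed.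

Definition prod_set N K : set G := [set x | exists2 y, N y & K (y^-1 * x)%g].

Lemma prod_subgroup N K : is_normal N -> is_subgroup K ->
  is_subgroup (prod_set N K).
Proof.
move=> nN [K1 KM KV]; have [[N1 NM NV] NJ] := nN; split.
- by exists 1%g; rewrite ?mulg1 ?invg1.
- move=> x y [u Nu Ku] [v Nv Kv].
  exists (u * ((u^-1 * x) * v * (u^-1 * x)^-1))%g; first by apply: NM => //; exact: NJ.
  rewrite (_ : _ * _ = (u^-1 * x) * (v^-1 * y))%g; first exact: KM.
  by rewrite !invgM !invgK !mulgA !(mulgK, mulgVK).
- move=> x [u Nu Ku]; exists (x^-1 * u^-1 * x)%g.
    by apply: normal_conjV => //; exact: NV.
  rewrite (_ : _ * _ = (u^-1 * x)^-1)%g; first exact: KV.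
  by rewrite !invgM !invgK !mulgA !(mulgK, mulgVK).
Qed.

Lemma prod_subl N K : is_subgroup K -> N `<=` prod_set N K.
Proof. by move=> [K1 _ _] x Nx; exists x => //; rewrite mulVg. Qed.

Lemma prod_subr N K : is_subgroup N -> K `<=` prod_set N K.
Proof. by move=> [N1 _ _] x Kx; exists 1%g => //; rewrite invg1 mul1g. Qed.

(** [prod_set N K] is a subgroup containing K, and strictly so since it contains N. *)
Lemma maximal_prod N K : is_maximal_subgroup K -> is_normal N ->
  ~ N `<=` K -> forall x, prod_set N K x.
Proof.
move=> [sK _ maxK] nN nNK x; have [sN _] := nN.
have [e|->//] := maxK _ (prod_subgroup nN sK) (prod_subr sN).
by case: nNK; rewrite -e; exact: prod_subl.
Qed.

Lemma subgroupI K L : is_subgroup K -> is_subgroup L -> is_subgroup (K `&` L).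
Proof.
move=> [K1 KM KV] [L1 LM LV]; split=> //.
  by move=> x y [Kx Lx] [Ky Ly]; split; [exact: KM|exact: LM].
by move=> x [Kx Lx]; split; [exact: KV|exact: LV].
Qed.

(** The condition on J says that N (K [&] L) is the whole group. Each x in K is then y z with y in N
    and z in K [&] L, which puts y in K [&] N, hence in L. Uniqueness of K will follow from its
    trace on N and a few known elements. *)
Lemma subgroup_sub N K L : is_normal N -> is_subgroup K -> is_subgroup L ->
  K `&` N `<=` L ->
  (forall J, is_subgroup J -> N `<=` J -> K `&` L `<=` J -> J = setT) ->
  K `<=` L.
Proof.
move=> nN sK sL KNL gen x Kx; have [sN _] := nN.
have sI := subgroupI sK sL.
have [K1 KM KV] := sK; have [L1 LM LV] := sL.
have eT := gen _ (prod_subgroup nN sI) (prod_subl (N := N) sI) (prod_subr sN).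
have [y Ny [Ky Ly]] : prod_set N (K `&` L) x by rewrite eT.
rewrite -[x](mulVKg y); apply: LM => //; apply: KNL; split=> //.
have -> : y = (x * (y^-1 * x)^-1)%g by rewrite invgM invgK mulgA mulgV mul1g.
by apply: KM => //; exact: KV.
Qed.

Section FiniteIndex.
Variables (K : set G) (n : nat).
Hypotheses (sK : is_subgroup K) (Kn : has_index K n).

(** Two of the n + 1 powers 1, x, ..., x^n lie in the same coset. *)
Lemma finite_index_exp x : exists2 d, (0 < d <= n)%N & K (x ^+ d)%g.
Proof.
have [r [ltr rP]] := index_fun sK Kn.
have [inj|] := pselect {in `I_n.+1 &, injective (fun i => r (x ^+ i)%g)}.
  have := pigeonhole inj.
  have sub : (fun i => r (x ^+ i)%g) @` `I_n.+1 `<=` `I_n by move=> _ [i _ <-] /=.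
  by move=> /(_ _ sub); rewrite ltnn.
move=> /existsNP[i /existsNP[j /not_implyP[/set_mem /= lei /not_implyP[/set_mem /= lej]]]].
move=> /not_implyP[e ne].
wlog ltij : i j lei lej e ne / (i < j)%N => [H|].
  have [/eqP|] := boolP (i == j); first by [].
  by rewrite neq_ltn => /orP[ij|ji]; [exact: (H i j) | apply: (H j i) => //; exact/nesym].
exists (j - i)%N; first by rewrite subn_gt0 ltij; lia.
move/rP: e; rewrite expgnFr 1?ltnW//.
have -> // : ((x ^+ i)^-1 * x ^+ j = x ^+ j * (x ^+ i)^-1)%g.
exact/commute_sym/commuteV/commuteX2/commute_refl.
Qed.

Lemma finite_index_gt0 : (0 < n)%N.
Proof. by have [d /andP[]] := finite_index_exp 1%g; lia. Qed.

(** For the least d > 0 with x^d in K, the powers x^0, ..., x^(d - 1) form a transversal, so d is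
    the index. *)
Lemma cyclic_index x : (forall g, exists z : int, K ((expz x z)^-1 * g)%g) ->
  forall z : int, K (expz x z) <-> (n%:Z %| z)%Z.
Proof.
move=> cyc; have [K1 KM KV] := sK.
have exP : exists d, (0 < d)%N && `[< K (x ^+ d)%g >].
  by have [d /andP[d0 _] Kd] := finite_index_exp x; exists d; rewrite d0; exact/asboolP.
have [d /andP[d0 /asboolP Kd] dmin] := ex_minnP exP.
have KdM q : K (expz x (d%:Z * q)) by rewrite expzM; exact: subgroup_expz.
have d0' : d%:Z != 0 by lia.
have main z : K (expz x z) <-> (d%:Z %| z)%Z.
  split=> [Kz|/dvdzP[q ->]]; last by rewrite mulrC.
  apply/dvdz_mod0P/eqP; apply/negPn/negP => mod0.
  have m0 := modz_ge0 z d0'; have ml := ltz_pmod z (_ : 0 < d%:Z).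
  have : (d <= `|(z %% d)%Z|)%N.
    apply: dmin; rewrite lt0n absz_eq0 mod0; apply/asboolP.
    rewrite -expz_nat gez0_abs//.
    have -> : (z %% d)%Z = z - d%:Z * (z %/ d)%Z by have := divz_eq z d; lia.
    by rewrite expzD expzN; apply: KM => //; exact: KV.
  by lia.
suff -> : n = d by [].
apply: (index_unique Kn); apply: (@transversal_index _ _ sK _ (fun i => x ^+ i)%g).
  move=> g; have [z Kz] := cyc g.
  have m0 := modz_ge0 z d0'; have ml := ltz_pmod z (_ : 0 < d%:Z).
  exists `|(z %% d)%Z|%N; first by lia.
  rewrite -expz_nat gez0_abs// -expzN.
  have -> : - (z %% d)%Z = d%:Z * (z %/ d)%Z + (- z) by have := divz_eq z d; lia.
  by rewrite expzD expzN -mulgA; exact: KM.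
move=> i j ltid ltjd; rewrite -!expz_nat -expzN -expzD => /main.
by rewrite addrC => /(dvdz_sub_small ltjd ltid).
Qed.

End FiniteIndex.

End IntegerPower.

(** * Maximal stable sublattices *)

Record stable_lattice (k : int) (L : int -> int -> Prop) : Prop := StableLattice {
  lat0 : L 0 0;
  latD : forall x y x' y', L x y -> L x' y' -> L (x + x') (y + y');
  latN : forall x y, L x y -> L (- x) (- y);
  latA : forall x y, L x y -> L y x;
  latB : forall x y, L x y -> L y (- x + k * y)
}.

Lemma lat_scale k L (z x y : int) :
  stable_lattice k L -> L x y -> L (z * x) (z * y).
Proof.
move=> sL Lxy; elim: z => [|n IH|n IH]; first by rewrite !mul0r; exact: (lat0 sL).
  by rewrite -addn1 PoszD !mulrDl !mul1r; exact: (latD sL).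
rewrite -addn1 PoszD opprD !mulrDl !mulN1r.
by apply: (latD sL) => //; exact: (latN sL).
Qed.

Lemma prime_bezoutz p (z : int) : prime p -> ~~ (p%:Z %| z)%Z ->
  exists u v : int, u * p%:Z + v * z = 1.
Proof.
move=> p_pr npz; have : coprimez p z.
  by rewrite /coprimez /gcdz /= eqz_nat -/(coprime _ _) prime_coprime.
by move=> /coprimezP[[u v] /= e]; exists u, v.
Qed.

Section MaximalLattice.
Variables (k : int) (L : int -> int -> Prop).
Hypothesis sL : stable_lattice k L.
Hypothesis proper : ~ (forall x y, L x y).
Hypothesis maxL : forall L', stable_lattice k L' ->
  (forall x y, L x y -> L' x y) ->
  (forall x y, L' x y -> L x y) \/ (forall x y, L' x y).
Hypothesis finL : exists2 m, (0 < m)%N & forall x y : int, L (m%:Z * x) (m%:Z * y).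

(** Take the least m > 0 with m Z^2 inside L, and m = q p with p prime. By maximality the stable
    lattice L + p Z^2 is L or everything. In the second case q Z^2 lies in q L + m Z^2, hence in L,
    against the choice of m. *)
Lemma maximal_lattice_prime :
  exists2 p, prime p & forall x y : int, L (p%:Z * x) (p%:Z * y).
Proof.
have exP : exists m, (0 < m)%N && `[< forall x y : int, L (m%:Z * x) (m%:Z * y) >].
  by have [m m0 Lm] := finL; exists m; rewrite m0; exact/asboolP.
have [m /andP[m0 /asboolP Lm] mmin] := ex_minnP exP.
have m1 : (1 < m)%N.
  rewrite ltn_neqAle m0 andbT; apply/eqP => m1; apply: proper => x y.
  by have := Lm x y; rewrite -m1 !mul1r.
exists (pdiv m); first exact: pdiv_prime.
set p := pdiv m; have p_pr : prime p by exact: pdiv_prime.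
have /dvdnP[q mE] : (p %| m)%N by exact: pdiv_dvd.
pose L' (x y : int) := exists u v : int, L (x - p%:Z * u) (y - p%:Z * v).
have sL' : stable_lattice k L'.
  split.
  - by exists 0, 0; rewrite !mulr0 subr0; exact: (lat0 sL).
  - move=> x y x' y' [u [v Luv]] [u' [v' Luv']]; exists (u + u'), (v + v').
    by have := latD sL Luv Luv'; congr L; ring.
  - move=> x y [u [v Luv]]; exists (- u), (- v).
    by have := latN sL Luv; congr L; ring.
  - by move=> x y [u [v Luv]]; exists v, u; exact: (latA sL).
  - move=> x y [u [v Luv]]; exists v, (- u + k * v).
    by have := latB sL Luv; congr L; ring.
have [x y Lxy||full] := maxL sL'; first by exists 0, 0; rewrite !mulr0 !subr0.
  move=> sub x y; apply: sub; exists x, y; rewrite !subrr; exact: (lat0 sL).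
have q0 : (0 < q)%N by move: m0; rewrite mE; case: (q).
suff : (m <= q)%N by rewrite mE; have := prime_gt1 p_pr; nia.
apply: mmin; rewrite q0; apply/asboolP => x y.
have [u [v Luv]] := full x y.
have := latD sL (lat_scale q sL Luv) (Lm u v).
by rewrite mE PoszM; congr L; ring.
Qed.

Variable p : nat.
Hypothesis p_pr : prime p.
Hypothesis Lp : forall x y : int, L (p%:Z * x) (p%:Z * y).

Lemma lat_unit (x y z : int) :
  ~~ (p%:Z %| z)%Z -> L (z * x) (z * y) -> L x y.
Proof.
move=> /(prime_bezoutz p_pr)[u [v uv]] /(lat_scale v sL) Lz.
have := latD sL (lat_scale u sL (Lp x y)) Lz.
by rewrite !mulrA -!mulrDl uv !mul1r.
Qed.

(** Modulo p, L contains the line through (1, e); a point off this line would yield (0, 1), and then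
    L would be everything. *)
Lemma lat_diag (e : int) : L 1 e -> forall x y, L x y <-> (p%:Z %| y - e * x)%Z.
Proof.
move=> Le x y; split=> [Lxy|/dvdzP[q yE]]; last first.
  have := latD sL (lat_scale x sL Le) (Lp 0 q).
  by rewrite mulr1 mulr0 addr0 [_ * q]mulrC -yE; congr L; ring.
apply/negPn/negP => npt; apply: proper => x' y'.
have L01 : L 0 1.
  apply: (lat_unit npt); have := latD sL Lxy (lat_scale (- x) sL Le).
  by congr L; ring.
have := latD sL (lat_scale x' sL Le) (lat_scale (y' - e * x') sL L01).
by congr L; ring.
Qed.

(** For (x, y) in L outside p Z^2, the sum and difference with (y, x) are (x + y)(1, 1) and (x -
    y)(1, -1). If either coefficient is prime to p, one of the two diagonals is in L. *)
Lemma maximal_latticeE :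
  [\/ forall x y, L x y <-> (p%:Z %| x)%Z && (p%:Z %| y)%Z,
      forall x y, L x y <-> (p%:Z %| y - x)%Z |
      forall x y, L x y <-> (p%:Z %| y + x)%Z].
Proof.
have [sub|] := pselect (forall x y, L x y -> (p%:Z %| x)%Z && (p%:Z %| y)%Z).
  apply: Or31 => x y; split=> [|/andP[/dvdzP[u ->] /dvdzP[v ->]]]; first exact: sub.
  by rewrite ![_ * p%:Z]mulrC.
move=> /existsNP[x /existsNP[y /not_implyP[Lxy /negP npxy]]].
suff [L11|L1N] : L 1 1 \/ L 1 (-1).
- by apply: Or32 => x' y'; rewrite -[X in y' - X]mul1r; exact: lat_diag.
- by apply: Or33 => x' y'; rewrite -[X in y' + X]opprK -[X in - X]mulN1r; exact: lat_diag.
have Lyx := latA sL Lxy.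
have [pD|npD] := boolP (p%:Z %| x + y)%Z; last first.
  left; apply: (lat_unit npD); have := latD sL Lxy Lyx.
  by congr L; ring.
have [pB|npB] := boolP (p%:Z %| x - y)%Z; last first.
  right; apply: (lat_unit npB); have := latD sL Lxy (latN sL Lyx).
  by congr L; ring.
have p2x : (p%:Z %| 2 * x)%Z by have := rpredD pD pB; congr dvdz; ring.
have p2y : (p%:Z %| 2 * y)%Z by have := rpredB pD pB; congr dvdz; ring.
(* Both coefficients vanish modulo p only if p = 2 with x and y odd, and then (x, y) is congruent to
   (1, 1). *)
have [p2|odd_p] := even_prime p_pr; last first.
  have cop : coprimez p 2.
    by rewrite /coprimez /gcdz /= eqz_nat -/(coprime _ _) coprimen2.
  by move: npxy; rewrite -(Gauss_dvdzr _ cop) p2x -(Gauss_dvdzr _ cop) p2y.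
left; move: npxy pD; rewrite p2 => npxy /dvdzP[q xyE].
have [u [v [xE yE]]] : exists u v : int, x = 1 + 2 * u /\ y = 1 + 2 * v.
  exists ((x - 1) %/ 2)%Z, ((y - 1) %/ 2)%Z.
  by move: npxy; rewrite negb_and => /orP[]; lia.
have := latD sL Lxy (latN sL (Lp u v)).
by rewrite xE yE p2; congr L; ring.
Qed.

End MaximalLattice.

(** * Subgroups containing the translations *)

Section SemidirectH.
Variable k : int.
Local Notation H := (Hgrp k).

Definition lift_gen (x : bool) : H := sd_inr (Z2_action k) (pres_gen _ x).
Local Notation ha := (lift_gen true).
Local Notation hb := (lift_gen false).
Local Notation tr := (sd_inl (Z2_action k)).

Definition translations : set H := [set x | x.2 = 1%g].

Lemma trE (x : H) : translations x -> x = tr x.1.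
Proof. by case: x => v g; rewrite /translations /= => ->. Qed.

Lemma trD u v : tr (u + v) = (tr u * tr v)%g.
Proof. by rewrite sd_mulE /sd_inl /= rho_act1 mulg1. Qed.

Lemma trN v : tr (- v) = ((tr v)^-1)%g.
Proof. by apply/esym/mulg1_eq; rewrite -trD subrr. Qed.

Lemma inrM g h : sd_inr (Z2_action k) (g * h)%g =
  (sd_inr (Z2_action k) g * sd_inr (Z2_action k) h)%g.
Proof. by rewrite sd_mulE /= mulmx0 addr0. Qed.

Lemma inrV g : sd_inr (Z2_action k) (g^-1)%g = ((sd_inr (Z2_action k) g)^-1)%g.
Proof. by apply/esym/mulg1_eq; rewrite -inrM mulgV. Qed.

Lemma translations_normal : is_normal translations.
Proof.
split; first split.
- by [].
- by move=> x y; rewrite /translations /= => -> ->; rewrite mulg1.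
- by move=> x; rewrite /translations /= => ->; rewrite invg1.
- by move=> x y; rewrite /translations /= => ->; rewrite mulg1 mulgV.
Qed.

Lemma Hgrp_gen (L : set H) :
  is_subgroup L -> translations `<=` L -> L ha -> L hb -> L = setT.
Proof.
move=> [L1 LM LV] TL La Lb; apply/seteqP; split=> // -[v g] _.
have -> : (v, g) = (tr v * sd_inr (Z2_action k) g)%g.
  by rewrite sd_mulE /= rho_act1 addr0 mul1g.
apply: (LM); first exact: TL.
have Lgen x : L (lift_gen x) by case: x.
rewrite -[g]pres_class_repr; elim: (repr g) => [|[x e] w IH].
  by apply: TL.
rewrite -cat1s pres_class_cat inrM; apply: (LM) => //.
case: e; last exact: Lgen.
have -> : [:: (x, true)] = inv_word [:: (x, false)] by [].
rewrite pres_class_inv (_ : sd_inr _ _ = (lift_gen x)^-1)%g; first exact: LV.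
by apply/esym/mulg1_eq; rewrite -inrM mulgV.
Qed.

Lemma gen_relation : (pres_gen [set relator] true * pres_gen _ false *
  (pres_gen _ true)^-1 = (pres_gen _ false)^-1)%g.
Proof.
apply/esym/mulg1_eq.
have : pres_class [set relator] relator = 1%g by apply/pres_classP/PresRel.
rewrite (_ : relator = [:: (true, false)] ++ [:: (false, false)] ++
  inv_word [:: (true, false)] ++ [:: (false, false)])//.
rewrite !pres_class_cat pres_class_inv -!/(pres_gen _ _) => e.
apply: (mulIg (pres_gen [set relator] false)); rewrite mul1g -!mulgA.
have {}e : (pres_gen [set relator] true * (pres_gen _ false *
  ((pres_gen _ true)^-1 * pres_gen _ false)))%g = 1%g by [].
by rewrite e mulg1.
Qed.

Lemma lift_relation : (ha * hb * ha^-1 = hb^-1)%g.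
Proof.
by rewrite /lift_gen -!inrV -!inrM gen_relation.
Qed.

Definition trans_b : set H := prod_set translations (range (expz hb)).

Lemma trans_b_sub : is_subgroup trans_b.
Proof. by apply: prod_subgroup; [exact: translations_normal|exact: expz_subgroup]. Qed.

Lemma translations_trans_b : translations `<=` trans_b.
Proof. exact: prod_subl (expz_subgroup _). Qed.

Lemma trans_b_hb (z : int) : trans_b (expz hb z).
Proof. by apply: (prod_subr (proj1 translations_normal)); exists z. Qed.

(** The elements normalising [trans_b] form a subgroup containing T, a and b. Conjugation by x and
    by x^-1 are both required in [S], so that it is closed under inverses. *)
Lemma trans_b_normal : is_normal trans_b.
Proof.
have sC := trans_b_sub; have [C1 CM CV] := sC.
split=> // x; pose S := [set x : H | forall y, trans_b y ->
  trans_b (x * y * x^-1)%g /\ trans_b (x^-1 * y * x)%g].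
suff eS : S = setT.
  by move=> y Cy; have : S x by [rewrite eS]; case/(_ y Cy).
have CS : trans_b `<=` S.
  by move=> y Cy z Cz; split; do ?apply: (CM) => //; exact: CV.
apply: Hgrp_gen.
- split.
  + by move=> y Cy; rewrite invg1 !mul1g !mulg1.
  + move=> y z Sy Sz u Cu; rewrite invgM.
    have [/Sy[Czu _] _] := Sz u Cu; have [_ /Sz[_ Cyu]] := Sy u Cu.
    by split; [move: Czu | move: Cyu]; rewrite !mulgA.
  + by move=> y Sy u Cu; rewrite invgK; have [] := Sy u Cu.
- by apply: subset_trans CS; exact: translations_trans_b.
- have [sT TJ] := translations_normal.
  move=> y [v Tv [z _ zE]]; have -> : y = (v * expz hb z)%g by rewrite zE mulVKg.
  have relV : (ha^-1 * hb * ha = hb^-1)%g.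
    have e : (hb = ha * hb^-1 * ha^-1)%g.
      by rewrite -[LHS]invgK -[in LHS]lift_relation !invgM invgK !mulgA.
    by rewrite {1}e !mulgA mulVg mul1g mulgVK.
  split.
    rewrite (_ : _ * _ = (ha * v * ha^-1) * (ha * expz hb z * ha^-1))%g; last first.
      by rewrite !mulgA mulgVK.
    apply: CM; first by apply: translations_trans_b; exact: TJ.
    rewrite expz_conj lift_relation.
    by apply: subgroup_expz => //; apply: CV; exact: (trans_b_hb 1).
  rewrite (_ : _ * _ = (ha^-1 * v * ha) * (ha^-1 * expz hb z * ha))%g; last first.
    by rewrite !mulgA mulgK.
  apply: CM; first by apply: translations_trans_b; apply: normal_conjV.
  have := expz_conj ha^-1%g hb z; rewrite invgK relV => ->.
  by apply: subgroup_expz => //; apply: CV; exact: (trans_b_hb 1).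
- exact: CS (trans_b_hb 1).
Qed.

Lemma trans_b_a : prod_set trans_b (range (expz ha)) = setT.
Proof.
have sP := prod_subgroup trans_b_normal (expz_subgroup ha).
have CP := prod_subl (N := trans_b) (expz_subgroup ha).
apply: Hgrp_gen => //.
- by apply: subset_trans CP; exact: translations_trans_b.
- by apply: (prod_subr trans_b_sub); exists 1.
- by apply: CP; exact: (trans_b_hb 1).
Qed.

Lemma trans_b_subset (K : set H) :
  is_subgroup K -> translations `<=` K -> K hb -> trans_b `<=` K.
Proof.
move=> sK TK Kb x [y /TK Ky [z _ xE]]; rewrite -[x](mulVKg y) -xE.
by have [_ KM _] := sK; apply: KM => //; exact: subgroup_expz.
Qed.

Section FiniteIndexSubgroup.
Variables (K : set H) (n : nat).
Hypotheses (sK : is_subgroup K) (Kn : has_index K n).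
Hypothesis TK : translations `<=` K.

Lemma index_a : K hb -> forall z, K (expz ha z) <-> (n%:Z %| z)%Z.
Proof.
move=> Kb; apply: (cyclic_index sK Kn) => g.
have CK := trans_b_subset sK TK Kb; have [_ KM KV] := sK.
(* Writing g^-1 = y a^z with y in K gives a^z g = y^-1 in K. *)
have [y /CK Ky [z _ zE]] : prod_set trans_b (range (expz ha)) g^-1%g.
  by rewrite trans_b_a.
exists (- z); rewrite expzN invgK zE -mulgA mulVg mulg1; exact: KV.
Qed.

(** As b is not in K, maximality makes the product of [trans_b] and K everything, and the
    translation part is absorbed by K. *)
Lemma trans_b_cosets : is_maximal_subgroup K -> ~ K hb ->
  forall g, exists z : int, K ((expz hb z)^-1 * g)%g.
Proof.
move=> maxK nKb g; have [_ KM KV] := sK.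
have nCK : ~ trans_b `<=` K by move=> /(_ _ (trans_b_hb 1)).
have [c [v Tv [z _ zE]] Kcg] := maximal_prod maxK trans_b_normal nCK g.
exists z; rewrite zE invgM invgK.
rewrite (_ : _ * _ * g = (c^-1 * v * c) * (c^-1 * g))%g; last first.
  by rewrite !mulgA mulgK.
by apply: KM => //; apply: TK; exact: normal_conjV translations_normal Tv.
Qed.

Lemma index_b : is_maximal_subgroup K -> ~ K hb ->
  forall z, K (expz hb z) <-> (n%:Z %| z)%Z.
Proof.
move=> maxK nKb; apply: (cyclic_index sK Kn); exact: trans_b_cosets.
Qed.

Lemma index_b_a : is_maximal_subgroup K -> ~ K hb ->
  exists2 i, (i < n)%N & K (hb ^+ i * ha)%g.
Proof.
move=> maxK nKb; have [z Kz] := trans_b_cosets maxK nKb ha.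
have n0 := finite_index_gt0 sK Kn; have n0' : n%:Z != 0 by lia.
have m0 := modz_ge0 (- z) n0'; have ml := ltz_pmod (- z) (_ : 0 < n%:Z).
exists `|(- z %% n)%Z|%N; first by lia.
rewrite -expz_nat gez0_abs//.
have -> : (- z %% n)%Z = n%:Z * (- (- z %/ n)%Z) - z.
  by have := divz_eq (- z) n; lia.
rewrite expzD expzN -mulgA; have [_ KM _] := sK; apply: KM => //.
by apply/(index_b maxK nKb); rewrite dvdz_mulr.
Qed.

End FiniteIndexSubgroup.

Lemma subgroup_a_unique (K K' : set H) n :
  is_subgroup K -> has_index K n -> translations `<=` K -> K hb ->
  is_subgroup K' -> has_index K' n -> translations `<=` K' -> K' hb ->
  K `<=` K'.
Proof.
move=> sK Kn TK Kb sK' Kn' TK' Kb' x Kx.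
have CK := trans_b_subset sK TK Kb; have CK' := trans_b_subset sK' TK' Kb'.
have [y Cy [z _ zE]] : prod_set trans_b (range (expz ha)) x by rewrite trans_b_a.
have [_ KM KV] := sK; have [_ KM' KV'] := sK'.
rewrite -[x](mulVKg y) -zE; apply: (KM'); first exact: CK'.
apply/(index_a sK' Kn' TK' Kb')/(index_a sK Kn TK Kb); rewrite zE.
by apply: KM => //; apply/KV/CK.
Qed.

(** [subgroup_sub] with N = [trans_b]: both subgroups meet N in the elements of T b^z with n | z,
    and the common element b^i a generates H_k together with N. *)
Lemma subgroup_b_unique (K K' : set H) n (i : nat) :
  is_maximal_subgroup K -> has_index K n -> translations `<=` K -> ~ K hb ->
  K (hb ^+ i * ha)%g ->
  is_maximal_subgroup K' -> has_index K' n -> translations `<=` K' -> ~ K' hb ->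
  K' (hb ^+ i * ha)%g ->
  K `<=` K'.
Proof.
move=> maxK Kn TK nKb Kia maxK' Kn' TK' nKb' Kia'.
have [sK _ _] := maxK; have [sK' _ _] := maxK'.
apply: (subgroup_sub trans_b_normal sK sK') => [x [Kx [y Ty [z _ zE]]]|J sJ CJ IJ].
  have [_ KM KV] := sK; have [_ KM' KV'] := sK'.
  rewrite -[x](mulVKg y) -zE; apply: (KM'); first exact: TK'.
  apply/(index_b sK' Kn' TK' maxK' nKb')/(index_b sK Kn TK maxK nKb); rewrite zE.
  by apply: KM => //; apply/KV/TK.
have [_ JM JV] := sJ; apply: Hgrp_gen => //.
- by apply: subset_trans CJ; exact: translations_trans_b.
- rewrite -[ha](mulKg (hb ^+ i)%g); apply: JM; last by apply: IJ.
  by apply: JV; apply: CJ; exact: (trans_b_hb i%:Z).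
- by apply: CJ; exact: (trans_b_hb 1).
Qed.

End SemidirectH.

(** * Subgroups not containing the translations *)

(* None stands for the sublattice p Z^2, of index p^2, and [Some true],
   [Some false] for the ones of index p containing (1, 1), resp. (1, -1). *)
Definition lat_code (c : option bool) (p : nat) (x y : int) : bool :=
  if c is Some e then (p%:Z %| if e then y - x else y + x)%Z
  else (p%:Z %| x)%Z && (p%:Z %| y)%Z.

(** Coset representatives of the lattice: p points on the second axis, or the p by p box enumerated
    in base p. *)
Definition lat_rep (c : option bool) (p i : nat) : int * int :=
  if c is Some _ then (0, i%:Z) else ((i %/ p)%N%:Z, (i %% p)%N%:Z).

Definition lat_index (c : option bool) (p : nat) : nat :=
  if c is Some _ then p else (p ^ 2)%N.

Lemma residue p (z : int) : (0 < p)%N ->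
  exists2 i, (i < p)%N & (p%:Z %| z - i%:Z)%Z.
Proof.
move=> p0; have p0' : p%:Z != 0 by lia.
have m0 := modz_ge0 z p0'; have ml := ltz_pmod z (_ : 0 < p%:Z).
exists `|(z %% p)%Z|%N; first by lia.
by rewrite gez0_abs// {1}(divz_eq z p) addrK dvdz_mull.
Qed.

Lemma lat_rep_surj c p (x y : int) : (0 < p)%N -> exists2 i, (i < lat_index c p)%N &
  lat_code c p (x - (lat_rep c p i).1) (y - (lat_rep c p i).2).
Proof.
move=> p0; case: c => [e|] /=.
  have [i ltip pi] := residue (if e then y - x else y + x) p0.
  exists i => //; move: pi; case: e; congr dvdz; ring.
have [i ltip pi] := residue x p0; have [j ltjp pj] := residue y p0.
exists (i * p + j)%N; first by rewrite -mulnn; nia.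
by rewrite divnMDl// modnMDl divn_small// addn0 modn_small// pi.
Qed.

Lemma lat_rep_inj c p i j : (0 < p)%N ->
  (i < lat_index c p)%N -> (j < lat_index c p)%N ->
  lat_code c p ((lat_rep c p j).1 - (lat_rep c p i).1)
               ((lat_rep c p j).2 - (lat_rep c p i).2) -> i = j.
Proof.
move=> p0; case: c => [e|] /= lti ltj.
  case: e; rewrite subrr ?subr0 ?addr0 => /(dvdz_sub_small ltj lti); exact: esym.
have div_lt a : (a < p ^ 2)%N -> (a %/ p < p)%N by rewrite ltn_divLR// mulnn.
move=> /andP[/(dvdz_sub_small (div_lt _ ltj) (div_lt _ lti)) e1].
move=> /(dvdz_sub_small (ltn_pmod _ p0) (ltn_pmod _ p0)) e2.
by rewrite [LHS](divn_eq i p) [RHS](divn_eq j p) e1 e2.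
Qed.

(** Since the index determines p, the prime adds nothing to the number of codes. *)
Lemma pdiv_lat_index c p : prime p -> pdiv (lat_index c p) = p.
Proof. by case: c => [e|] p_pr /=; [exact: pdiv_id | exact: pdiv_pfactor]. Qed.

Section NonContaining.
Variable k : int.
Local Notation H := (Hgrp k).
Local Notation ha := (lift_gen k true).
Local Notation hb := (lift_gen k false).
Local Notation tr := (sd_inl (Z2_action k)).

Lemma act_a x y : rho k (pres_gen _ true) *m vec x y = vec y x.
Proof. by rewrite rho_a mx22_vec; congr vec; ring. Qed.

Lemma act_b x y : rho k (pres_gen _ false) *m vec x y = vec y (- x + k * y).
Proof. by rewrite rho_b mx22_vec; congr vec; ring. Qed.

Lemma act_aV x y : rho k (pres_gen _ true)^-1%g *m vec x y = vec y x.
Proof. by rewrite -(act_a y x) -rho_actM mulVg rho_act1. Qed.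

Lemma act_bV x y : rho k (pres_gen _ false)^-1%g *m vec x y = vec (k * x - y) x.
Proof.
have -> : vec x y = rho k (pres_gen _ false) *m vec (k * x - y) x.
  by rewrite act_b; congr vec; ring.
by rewrite -rho_actM mulVg rho_act1.
Qed.

Lemma tr_conj (h : H) v : (h * tr v * h^-1)%g = tr (rho k h.2 *m v).
Proof.
rewrite !sd_mulE /= mulg1 mulgV mulmxN -rho_actM mulgV rho_act1.
by rewrite addrC addrA addNr add0r.
Qed.

Lemma tr_vecX x y d : (tr (vec x y) ^+ d)%g = tr (vec (d%:Z * x) (d%:Z * y)).
Proof.
elim: d => [|d IH].
  by rewrite expg0 !mul0r; congr sd_inl; apply/colP => i; rewrite !mxE if_same.
by rewrite expgS IH -trD vecD; congr (sd_inl _ (vec _ _)); lia.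
Qed.

Lemma stable_lattice_rho (L : int -> int -> Prop) (h : H) (v : 'cV[int]_2) :
  stable_lattice k L -> L (v 0 0) (v 1 0) ->
  L ((rho k h.2 *m v) 0 0) ((rho k h.2 *m v) 1 0).
Proof.
move=> sL; pose Lv (u : 'cV[int]_2) := L (u 0 0) (u 1 0).
pose S := [set h : H | forall u, Lv u -> Lv (rho k h.2 *m u) /\
                                     Lv (rho k (h^-1)%g.2 *m u)].
suff eS : S = setT.
  by move=> Lvv; have : S h by [rewrite eS]; case/(_ v Lvv).
apply: Hgrp_gen.
- split=> [u Lu|x y Sx Sy u Lu|x Sx u Lu].
  + by rewrite invg1 /= !rho_act1.
  + rewrite invgM !sd_mulE /= !rho_actM.
    have [/Sx[Lxy _] _] := Sy u Lu; have [_ /Sy[_ Lyx]] := Sx u Lu.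
    by split.
  + by rewrite invgK; have [] := Sx u Lu.
- move=> x /= Tx u Lu; have -> : (x^-1)%g.2 = (x.2^-1)%g by [].
  by rewrite Tx invg1 !rho_act1.
- move=> u; rewrite (vecE u); move: (u 0 0) (u 1 0) => x y.
  have -> : (lift_gen k true)^-1%g.2 = ((pres_gen _ true)^-1)%g by [].
  rewrite /Lv act_a act_aV !vec0 !vec1 => Lu.
  by split; exact: (latA sL).
- move=> u; rewrite (vecE u); move: (u 0 0) (u 1 0) => x y.
  have -> : (lift_gen k false)^-1%g.2 = ((pres_gen _ false)^-1)%g by [].
  rewrite /Lv act_b act_bV !vec0 !vec1 => Lu.
  split; first exact: (latB sL).
  (* B^-1 = A B A, from the relation and A^2 = 1. *)
  have := latA sL (latB sL (latA sL Lu)).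
  by congr L; ring.
Qed.

Section Subgroup.
Variables (K : set H) (n : nat).
Hypotheses (maxK : is_maximal_subgroup K) (Kn : has_index K n).
Hypothesis nTK : ~ translations (k := k) `<=` K.
Let sK : is_subgroup K. Proof. by case: maxK. Qed.

Definition trace_lattice (x y : int) : Prop := K (tr (vec x y)).

Lemma translation_coset (h : H) : exists v : 'cV[int]_2, K ((tr v)^-1 * h)%g.
Proof.
have [y Ty Kh] := maximal_prod maxK (translations_normal k) nTK h.
by exists y.1; rewrite -trE.
Qed.

(** Every g in G_2 is the second component of some element of K, and conjugation by that element
    acts on T as g does, because T is abelian. *)
Lemma trace_lattice_stable : stable_lattice k trace_lattice.
Proof.
have [K1 KM KV] := sK.
have stab g u : K (tr u) -> K (tr (rho k g *m u)).
  move=> Ku; have [v Kh] := translation_coset (sd_inr _ g).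
  have e : ((tr v)^-1 * sd_inr _ g)%g.2 = g by rewrite sd_mulE /= invg1 mul1g.
  rewrite -[in rho k g]e -tr_conj.
  by apply: (KM); [exact: KM | exact: KV].
split; rewrite /trace_lattice.
- by rewrite (_ : tr _ = 1%g)//; congr sd_inl; apply/colP => i; rewrite !mxE if_same.
- by move=> x y x' y' Kx Ky; rewrite -vecD trD; exact: KM.
- by move=> x y Kx; rewrite -vecN trN; exact: KV.
- by move=> x y /(stab (pres_gen _ true)); rewrite act_a.
- by move=> x y /(stab (pres_gen _ false)); rewrite act_b.
Qed.

Lemma trace_lattice_proper : ~ forall x y, trace_lattice x y.
Proof. by move=> full; apply: nTK => x /trE ->; rewrite (vecE x.1); exact: full. Qed.

(** A stable L gives a subgroup N of T normal in H_k. If N is not inside K, then every translation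
    is a product of elements of N and of K; the second factor is itself a translation, so it lies in
    the trace lattice and hence in L. *)
Lemma trace_lattice_maximal L : stable_lattice k L ->
  (forall x y, trace_lattice x y -> L x y) ->
  (forall x y, L x y -> trace_lattice x y) \/ (forall x y, L x y).
Proof.
move=> sL sub; pose N := [set x : H | x.2 = 1%g /\ L (x.1 0 0) (x.1 1 0)].
have [NK|nNK] := pselect (N `<=` K).
  by left=> x y Lxy; apply: NK; split=> //=; rewrite vec0 vec1.
right=> x y; have NE u : N (tr u) <-> L (u 0 0) (u 1 0) by split=> [[]|].
have nN : is_normal N.
  split; first split.
  - by split=> //=; rewrite !mxE; exact: (lat0 sL).
  - move=> u v [/trE -> /= Lu] [/trE -> /= Lv].
    by rewrite -trD; apply/NE; rewrite !mxE; exact: (latD sL).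
  - move=> u [/trE -> /= Lu].
    by rewrite -trN; apply/NE; rewrite !mxE; exact: (latN sL).
  - move=> h u [/trE -> /= Lu]; rewrite tr_conj.
    by apply/NE; exact: stable_lattice_rho.
have [u [/trE uE Lu]] := maximal_prod maxK nN nNK (tr (vec x y)).
rewrite uE -trN -trD (vecE u.1) vecN vecD => /sub Lxy.
by have := latD sL Lu Lxy; congr L; ring.
Qed.

Lemma trace_lattice_finite : exists2 m, (0 < m)%N &
  forall x y : int, trace_lattice (m%:Z * x) (m%:Z * y).
Proof.
(* Each translation has a power of exponent d <= n in K, and n! is a common multiple of all such
   d. *)
exists n`!; first exact: fact_gt0.
move=> x y; have [d /andP[d0 ledn] Kd] := finite_index_exp sK Kn (tr (vec x y)).
have /dvdnP[q ->] : (d %| n`!)%N by rewrite dvdn_fact// d0.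
move: Kd; rewrite tr_vecX PoszM -!mulrA => Kd.
exact: (lat_scale q trace_lattice_stable Kd).
Qed.

(** Every coset of K contains a translation, so representatives of Z^2 modulo the trace lattice also
    represent the cosets of K. The index is therefore p or p^2, and p = [pdiv n]. *)
Lemma trace_lattice_codeE : prime (pdiv n) /\ exists c,
  n = lat_index c (pdiv n) /\
  forall x y, trace_lattice x y <-> lat_code c (pdiv n) x y.
Proof.
have [p p_pr Lp] := maximal_lattice_prime trace_lattice_stable
  trace_lattice_proper trace_lattice_maximal trace_lattice_finite.
have [c cE] : exists c, forall x y, trace_lattice x y <-> lat_code c p x y.
  have [E|E|E] := maximal_latticeE trace_lattice_stable trace_lattice_proper p_pr Lp.
  - by exists None.
  - by exists (Some true).
  - by exists (Some false).
have p0 := prime_gt0 p_pr; have [K1 KM KV] := sK.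
suff nE : n = lat_index c p by rewrite nE pdiv_lat_index//; split=> //; exists c.
apply: (index_unique Kn).
pose s i := tr (vec (lat_rep c p i).1 (lat_rep c p i).2).
apply: (@transversal_index _ _ sK _ s) => [g|i j lti ltj].
  have [v Kv] := translation_coset g.
  have [i lti /cE Ki] := lat_rep_surj c (v 0 0) (v 1 0) p0.
  exists i => //; rewrite -[g](mulVKg (tr v)) mulgA; apply: KM => //.
  move: Ki; rewrite /trace_lattice -vecD -vecN -vecE addrC trD trN.
  exact.
rewrite /s -trN -trD vecN vecD addrC [- _ + _]addrC => /cE.
exact: lat_rep_inj.
Qed.

Lemma lift_gen_rep c x : n = lat_index c (pdiv n) ->
  (forall x y, trace_lattice x y <-> lat_code c (pdiv n) x y) ->
  exists2 i, (i < n)%N &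
    K (tr (vec (lat_rep c (pdiv n) i).1 (lat_rep c (pdiv n) i).2) * lift_gen k x)%g.
Proof.
move=> nE cE; have [v Kv] := translation_coset (lift_gen k x).
have [pr_p _] := trace_lattice_codeE; have [_ KM KV] := sK.
(* K contains (tr v)^-1 times the generator, hence the class of -v is the one to represent. *)
have [i lti /cE Ki] := lat_rep_surj c (- v 0 0) (- v 1 0) (prime_gt0 pr_p).
exists i; first by rewrite nE.
rewrite -[lift_gen k x](mulVKg (tr v)) mulgA; apply: KM => //.
have -> : v = - vec (- v 0 0) (- v 1 0) by rewrite vecN !opprK -vecE.
rewrite -trD vecN vecD; move/KV: Ki; rewrite -trN vecN.
by congr (K (tr (vec _ _))); ring.
Qed.

End Subgroup.

End NonContaining.

(** * Upper bounds *)

Section Uniqueness.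
Variable k : int.
Local Notation H := (Hgrp k).
Local Notation ha := (lift_gen k true).
Local Notation hb := (lift_gen k false).
Local Notation tr := (sd_inl (Z2_action k)).

Lemma noncontaining_unique (K K' : set H) u v :
  is_subgroup K -> is_subgroup K' ->
  (forall x y, trace_lattice K x y -> trace_lattice K' x y) ->
  K (tr u * ha)%g -> K' (tr u * ha)%g ->
  K (tr v * hb)%g -> K' (tr v * hb)%g -> K `<=` K'.
Proof.
move=> sK sK' KK' Kua Kua' Kvb Kvb'.
apply: (subgroup_sub (translations_normal k) sK sK') => [x [Kx /trE xE]|J sJ TJ IJ].
  by move: Kx; rewrite xE (vecE x.1); exact: KK'.
have [_ JM JV] := sJ; have Jtr w : J ((tr w)^-1)%g by apply/JV/TJ.
apply: Hgrp_gen => //.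
  by rewrite -[ha](mulKg (tr u)); apply: JM => //; exact: IJ.
by rewrite -[hb](mulKg (tr v)); apply: JM => //; exact: IJ.
Qed.

(** The G_2 components cancel by the relation. If x and y lie in K, the resulting vector is in the
    trace lattice, which is a congruence between u and v. *)
Lemma relation_value u v :
  let x := (tr u * ha)%g in let y := (tr v * hb)%g in
  (x * y * x^-1 * y)%g = tr (u + rho k (pres_gen _ true) *m v
    - rho k (pres_gen _ false)^-1%g *m u + rho k (pres_gen _ false)^-1%g *m v).
Proof.
have trM w g : (tr w * sd_inr (Z2_action k) g)%g = ((w, g) : H).
  by rewrite sd_mulE /= rho_act1 addr0 mul1g.
rewrite /lift_gen !trM !sd_mulE /= mulmxN -rho_actM gen_relation mulVg.
by [].
Qed.

(* For a fixed lattice of translations and fixed v, the relation determines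
   (1 - B^-1) u modulo the lattice; multiply by 1 - B, since
   (1 - B) (1 - B^-1) = 2 - k. *)
Lemma noncontaining_shift_unique (K K' : set H) p (u u' v : 'cV[int]_2) :
  prime p -> ~~ (p%:Z %| k - 2)%Z ->
  is_subgroup K -> is_subgroup K' -> stable_lattice k (trace_lattice K') ->
  (forall x y, trace_lattice K x y <-> trace_lattice K' x y) ->
  (forall x y : int, trace_lattice K' (p%:Z * x) (p%:Z * y)) ->
  K (tr u * ha)%g -> K' (tr u' * ha)%g ->
  K (tr v * hb)%g -> K' (tr v * hb)%g -> K' (tr u * ha)%g.
Proof.
move=> p_pr npk sK sK' sL KK' Lp Ku Ku' Kv Kv'.
have relK (M : set H) w : is_subgroup M -> K (tr u * ha)%g -> M (tr w * ha)%g ->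
    M (tr v * hb)%g -> trace_lattice M
      (w 0 0 + v 1 0 - (k * w 0 0 - w 1 0) + (k * v 0 0 - v 1 0))
      (w 1 0 + v 0 0 - w 0 0 + v 0 0).
  move=> [M1 MM MV] _ Mw Mv.
  have : M (tr w * ha * (tr v * hb) * (tr w * ha)^-1 * (tr v * hb))%g.
    by apply: (MM) => //; apply: (MM); [exact: (MM) | exact: MV].
  rewrite relation_value {1 2}(vecE w) (vecE v) !act_a !act_bV.
  by rewrite !vecN !vecD !vec0 !vec1.
have /KK' L1 := relK K u sK Ku Ku Kv; have L2 := relK K' u' sK' Ku Ku' Kv'.
have L3 := latD sL L1 (latN sL L2).
have Ld : trace_lattice K' (u 0 0 - u' 0 0) (u 1 0 - u' 1 0).
  apply: (lat_unit sL p_pr Lp npk).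
  have := latD sL (latB sL L3) (latN sL L3).
  by congr trace_lattice; ring.
have [_ KM' _] := sK'.
have := KM' _ _ Ld Ku'; rewrite mulgA -trD [X in vec _ _ + X]vecE vecD !subrK.
by rewrite -vecE.
Qed.

End Uniqueness.

Lemma lat_code_scale c p (x y : int) : lat_code c p (p%:Z * x) (p%:Z * y).
Proof.
case: c => [[]|] /=; rewrite ?dvdz_mulr//.
  by rewrite -mulrBr dvdz_mulr.
by rewrite -mulrDr dvdz_mulr.
Qed.

Section UpperBound.
Variables (k : int) (n : nat).
Local Notation H := (Hgrp k).
Local Notation ha := (lift_gen k true).
Local Notation hb := (lift_gen k false).
Local Notation tr := (sd_inl (Z2_action k)).
Local Notation T := (translations (k := k)).
Local Notation rep c i :=
  (vec (lat_rep c (pdiv n) i).1 (lat_rep c (pdiv n) i).2).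

Definition containing_code (o : option 'I_n) (K : set H) : Prop := T `<=` K /\
  if o is Some i then ~ K hb /\ K (hb ^+ i * ha)%g else K hb.

Definition lattice_code (c : option bool) (K : set H) : Prop := [/\ ~ T `<=` K,
  n = lat_index c (pdiv n) &
  forall x y, trace_lattice K x y <-> lat_code c (pdiv n) x y].

Local Notation S := [set K : set H | is_maximal_subgroup K /\ has_index K n].

Lemma containing_code_ex K : S K -> T `<=` K -> exists o, containing_code o K.
Proof.
move=> [maxK Kn] TK; have [sK _ _] := maxK.
have [Kb|nKb] := pselect (K hb); first by exists None.
have [i ltin Ki] := index_b_a sK Kn TK maxK nKb.
by exists (Some (Ordinal ltin)).
Qed.

Lemma containing_code_inj o K K' : S K -> S K' ->
  containing_code o K -> containing_code o K' -> K = K'.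
Proof.
move=> [maxK Kn] [maxK' Kn'] [TK oK] [TK' oK'].
have [sK _ _] := maxK; have [sK' _ _] := maxK'.
case: o oK oK' => [i [nKb Ki] [nKb' Ki']|Kb Kb']; apply/seteqP; split.
- exact: (@subgroup_b_unique _ _ _ n i).
- exact: (@subgroup_b_unique _ _ _ n i).
- exact: (@subgroup_a_unique _ _ _ n).
- exact: (@subgroup_a_unique _ _ _ n).
Qed.

Lemma lattice_code_ex K : S K -> ~ T `<=` K ->
  exists c, lattice_code c K.
Proof.
move=> [maxK Kn] nTK.
by have [_ [c [nE cE]]] := trace_lattice_codeE maxK Kn nTK; exists c.
Qed.

Lemma lattice_code_rep c K x : S K -> lattice_code c K ->
  exists i : 'I_n, K (tr (rep c i) * lift_gen k x)%g.
Proof.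
move=> [maxK Kn] [nTK nE cE].
have [i ltin Ki] := lift_gen_rep maxK Kn nTK x nE cE.
by exists (Ordinal ltin).
Qed.

Lemma lattice_code_eq c K K' : lattice_code c K -> lattice_code c K' ->
  forall x y, trace_lattice K x y <-> trace_lattice K' x y.
Proof. by move=> [_ _ E] [_ _ E'] x y; split=> [/E/E'|/E'/E]. Qed.

Lemma lattice_code_inj2 c (i j : 'I_n) K K' : S K -> S K' ->
  lattice_code c K -> lattice_code c K' ->
  K (tr (rep c i) * ha)%g -> K' (tr (rep c i) * ha)%g ->
  K (tr (rep c j) * hb)%g -> K' (tr (rep c j) * hb)%g -> K = K'.
Proof.
move=> [[sK _ _] _] [[sK' _ _] _] cK cK' Ki Ki' Kj Kj'.
have E := lattice_code_eq cK cK'.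
apply/seteqP; split.
  exact: (noncontaining_unique sK sK' (fun x y => proj1 (E x y)) Ki Ki' Kj Kj').
exact: (noncontaining_unique sK' sK (fun x y => proj2 (E x y)) Ki' Ki Kj' Kj).
Qed.

(** Since n is p or p^2 with p = [pdiv n], the bound on n forces p > |k - 2| > 0. Hence p does not
    divide k - 2, and the class of v fixes that of u. *)
Lemma lattice_code_inj c (j : 'I_n) K K' : k <> 2 -> (`|k - 2| ^ 2 < n)%N ->
  S K -> S K' -> lattice_code c K -> lattice_code c K' ->
  K (tr (rep c j) * hb)%g -> K' (tr (rep c j) * hb)%g -> K = K'.
Proof.
move=> k2 ltkn SK SK' cK cK' Kj Kj'.
have [i Ki] := lattice_code_rep true SK cK.
(* It suffices that K' contains the same translate of a as K. *)
apply: (fun Ki' => lattice_code_inj2 SK SK' cK cK' Ki Ki' Kj Kj').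
have [maxK Kn] := SK; have [maxK' Kn'] := SK'.
have [sK _ _] := maxK; have [sK' _ _] := maxK'.
have [nTK' nE cE'] := cK'.
have [p_pr _] := trace_lattice_codeE maxK' Kn' nTK'.
have [i' Ki'] := lattice_code_rep true SK' cK'.
apply: (noncontaining_shift_unique p_pr _ sK sK' _ _ _ Ki Ki' Kj Kj').
- apply/negP => pk.
  have : (pdiv n <= `|k - 2|)%N by apply: dvdn_leq => //; lia.
  rewrite -(leq_exp2r _ _ (isT : 0 < 2)%N) => lep.
  suff : (n <= pdiv n ^ 2)%N by lia.
  rewrite {1}nE; case: (c) => [e|] //=.
  by have := prime_gt0 p_pr; nia.
- exact: (trace_lattice_stable maxK' nTK').
- exact: lattice_code_eq cK cK'.
- by move=> x y; apply/cE'; exact: lat_code_scale.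
Qed.

(** There are n + 1 codes for subgroups containing T and 3 n^2 for the others, three being the
    number of lattice types. *)
Lemma max_subgroup_count2_le (R : realType) : (0 < n)%N ->
  (max_subgroup_count R (Hgrp k) n <= (5 * n ^ 2)%N%:R%:E)%E.
Proof.
move=> n0; pose code (t : option 'I_n + option bool * ('I_n * 'I_n)) K :=
  match t with
  | inl o => containing_code o K
  | inr (c, (i, j)) => [/\ lattice_code c K, K (tr (rep c i) * ha)%g &
                          K (tr (rep c j) * hb)%g]
  end.
apply: le_trans (@counting_le R _ _ S code _ _) _.
- move=> K SK; have [TK|nTK] := pselect (T `<=` K).
    by have [d dK] := containing_code_ex SK TK; exists (inl d).
  have [c cK] := lattice_code_ex SK nTK.
  have [i Ki] := lattice_code_rep true SK cK.
  have [j Kj] := lattice_code_rep false SK cK.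
  by exists (inr (c, (i, j))).
- move=> [d|[c [i j]]] K K' SK SK'; first exact: containing_code_inj.
  by move=> [cK Ki Kj] [cK' Ki' Kj']; exact: (lattice_code_inj2 SK SK' cK cK' Ki Ki' Kj Kj').
- rewrite lee_fin ler_nat card_sum !card_prod !card_option card_bool !card_ord.
  by rewrite -mulnn; nia.
Qed.

(** The class of u is dropped from the code, leaving (n + 1) + 3 n <= 5 n codes. *)
Lemma max_subgroup_count_le (R : realType) : k <> 2 -> (`|k - 2| ^ 2 < n)%N ->
  (max_subgroup_count R (Hgrp k) n <= (5 * n ^ 1)%N%:R%:E)%E.
Proof.
move=> k2 ltkn; pose code (t : option 'I_n + option bool * 'I_n) K :=
  match t with
  | inl o => containing_code o K
  | inr (c, j) => lattice_code c K /\ K (tr (rep c j) * hb)%g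
  end.
apply: le_trans (@counting_le R _ _ S code _ _) _.
- move=> K SK; have [TK|nTK] := pselect (T `<=` K).
    by have [d dK] := containing_code_ex SK TK; exists (inl d).
  have [c cK] := lattice_code_ex SK nTK.
  have [j Kj] := lattice_code_rep false SK cK.
  by exists (inr (c, j)).
- move=> [d|[c j]] K K' SK SK'; first exact: containing_code_inj.
  by move=> [cK Kj] [cK' Kj']; exact: (lattice_code_inj k2 ltkn SK SK' cK cK' Kj Kj').
- rewrite lee_fin ler_nat card_sum !card_prod !card_option card_bool !card_ord.
  by lia.
Qed.

End UpperBound.

Theorem mainTheorem3 (R : realType) :
  mdeg R (Hgrp 2) = 2%:E /\
  (forall k : int, k <> 2 -> mdeg R (Hgrp k) = 1%:E).
Proof.
split=> [|k k2].
  apply: (@mdeg_eq R (Hgrp 2) 2 5).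
    by exists 1%N => // n /= n0; exact: max_subgroup_count2_le.
  by move=> p p_pr _; exact: max_subgroup_count2_ge.
apply: (@mdeg_eq R (Hgrp k) 1 5).
  by exists (`|k - 2| ^ 2).+1 => // n /= ltkn; exact: max_subgroup_count_le.
by move=> p p_pr _; rewrite expn1; exact: max_subgroup_count_ge.
Qed.
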